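(* For any constant $\epsilon$ of the form $\frac{1}{4c}$ with $c>0$ an even integer, there is an efficiently samplable distribution on $n$-vertex Min-Bisection instances such that, with high probability over the choice of instance: (i) there is a degree-$\Omega(n)$ SOS solution with objective value $\frac14+\epsilon$, in which the bisection identity and the objective value identity are satisfied exactly with pseudovariance zero; and (ii) every genuine bisection has objective value at least $\frac{5}{16}-\epsilon$. In particular, degree-$o(n)$ SOS does not deliver a factor-$(\frac54-\epsilon)$ approximation for Min-Bisection.
   Context: Min-Bisection: given a (multi)graph on $n$ vertices ($n$ even), find a partition of the vertices into two halves of size $n/2$ minimizing the fraction of edges cut. SOS formulation: a $\pm1$-valued indeterminate $u_v$ per vertex, the bisection identity $\sum_v u_v=0$, objective polynomial $\frac{1}{|E|}\sum_{\{a,b\}\in E}\frac{(u_a-u_b)^2}{4}$. A degree-$d$ SOS solution is a degree-$d$ pseudoexpectation $\widetilde{\mathbb{E}}$ (linear functional on polynomials of degree $\le d$, respecting $u_v^2=1$, $\widetilde{\mathbb{E}}[1]=1$, $\widetilde{\mathbb{E}}[Q^2]\ge0$ for $\deg Q\le d/2$); its objective value is $\widetilde{\mathbb{E}}$ of the objective polynomial; an identity $Q=b$ holds with pseudovariance zero if $\widetilde{\mathbb{E}}[Q]=b$ and $\widetilde{\mathbb{E}}[Q^2]=b^2$. *)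

(* Defs.v *)
(* World: MathComp, with the reals of MathComp-Analysis and multinomials. *)
From HB Require Import structures.
From mathcomp Require Import all_boot all_order all_algebra.
From mathcomp Require Import boolp reals.
From mathcomp Require Import mpoly.

Set Implicit Arguments.
Unset Strict Implicit.
Unset Printing Implicit Defensive.

Import Order.TTheory GRing.Theory Num.Theory.
Local Open Scope ring_scope.

(* Parallel edges are repetitions in the list; the orientation of a pair is
   irrelevant to every notion below. *)
Definition multigraph (n : nat) : Type :=
  {s : seq ('I_n * 'I_n) | all (fun e => e.1 != e.2) s}.

Definition edges n (G : multigraph n) : seq ('I_n * 'I_n) := sval G.

(* The bisection (S, ~: S) is represented by S. *)
Definition bisection n (S : {set 'I_n}) : Prop := (#|S|.*2 = n)%N.

Definition cut_fraction (R : realType) n (G : multigraph n) (S : {set 'I_n}) : R :=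
  (count (fun e => (e.1 \in S) != (e.2 \in S)) (edges G))%:R
    / (size (edges G))%:R.

Section SOS.
Variables (R : realType) (n : nat).

Definition degree_le (d : nat) (p : {mpoly R[n]}) : Prop := (msize p <= d.+1)%N.

(* A linear functional on polynomials of degree at most d is represented by a
   function on all polynomials, of which only the values in degree at most d
   are constrained. *)
Definition pseudoexpectation (d : nat) (E : {mpoly R[n]} -> R) : Prop :=
  [/\ forall (a : R) (p q : {mpoly R[n]}), degree_le d p -> degree_le d q ->
        E (a *: p + q) = a * E p + E q,
      E 1 = 1,
      forall (v : 'I_n) (p : {mpoly R[n]}), degree_le d ('X_v ^+ 2 * p) ->
        E ('X_v ^+ 2 * p) = E p
    & forall q : {mpoly R[n]}, degree_le d./2 q -> 0 <= E (q ^+ 2)].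

Definition pseudovariance_zero (E : {mpoly R[n]} -> R)
    (Q : {mpoly R[n]}) (b : R) : Prop :=
  E Q = b /\ E (Q ^+ 2) = b ^+ 2.

Definition bisection_poly : {mpoly R[n]} := \sum_(v < n) 'X_v.

Definition objective_poly (G : multigraph n) : {mpoly R[n]} :=
  (size (edges G))%:R^-1 *:
    \sum_(e <- edges G) 4^-1 *: ('X_(e.1) - 'X_(e.2)) ^+ 2.

End SOS.

Arguments bisection_poly : clear implicits.

(* A randomised RAM, as a structured language over memory cells indexed by and
   holding natural numbers.  Every step has unit cost; since the only arithmetic
   is addition and truncated subtraction, contents after t steps have length
   O(t + log n), so that polynomial time here is polynomial time for
   probabilistic Turing machines. *)
Inductive cmd : Type :=
| Skip
| Const of nat & nat          (* Const r x : m[r] := x *)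
| Add of nat & nat & nat      (* Add r s t : m[r] := m[s] + m[t] *)
| Sub of nat & nat & nat      (* Sub r s t : m[r] := m[s] - m[t], truncated *)
| Fetch of nat & nat          (* Fetch r s : m[r] := m[m[s]] *)
| Store of nat & nat          (* Store r s : m[m[r]] := m[s] *)
| Flip of nat                 (* Flip r : m[r] := a fresh uniform bit *)
| Seq of cmd & cmd
| If of nat & cmd & cmd       (* If r c1 c2 : c1 if m[r] <> 0, else c2 *)
| While of nat & cmd.         (* While r c : repeat c as long as m[r] <> 0 *)

Definition memory : Type := nat -> nat.

Definition update (m : memory) (a x : nat) : memory :=
  fun b => if b == a then x else m b.

(* The commands still to be executed, with the memory; the machine has halted
   when no command remains. *)
Definition config : Type := (seq cmd * memory)%type.

(* Each time step comes with its own bit, which only Flip reads. *)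
Definition step (s : config) (bit : bool) : config :=
  let: (k, m) := s in
  match k with
  | [::] => s
  | Skip :: k => (k, m)
  | Const r x :: k => (k, update m r x)
  | Add r s t :: k => (k, update m r (m s + m t)%N)
  | Sub r s t :: k => (k, update m r (m s - m t)%N)
  | Fetch r s :: k => (k, update m r (m (m s)))
  | Store r s :: k => (k, update m (m r) (m s))
  | Flip r :: k => (k, update m r bit)
  | Seq c1 c2 :: k => (c1 :: c2 :: k, m)
  | If r c1 c2 :: k => ((if m r == 0%N then c2 else c1) :: k, m)
  | While r c :: k => (if m r == 0%N then k else c :: While r c :: k, m)
  end.

(* Cell 0 initially holds n, every other cell holds 0. *)
Definition run (c : cmd) (n : nat) (w : seq bool) : config :=
  foldl step ([:: c], fun a => if a == 0%N then n else 0%N) w.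

(* Cell 0 holds the number of edges and cell 1 the address from which the
   endpoints of the successive edges are listed. *)
Definition output (m : memory) : seq (nat * nat) :=
  [seq (m (m 1 + i.*2), m (m 1 + i.*2).+1)%N | i <- iota 0 (m 0%N)].

(* G n is a random n-vertex multigraph, as a function of T n uniform coins.  It
   is efficiently samplable when one program, on input n, outputs G n w within
   T n steps on every coin tape w, T being polynomially bounded. *)
Definition efficiently_samplable (T : nat -> nat)
    (G : forall n, (T n).-tuple bool -> multigraph n) : Prop :=
  exists (c : cmd) (k : nat),
    (forall n, (T n <= n ^ k + k)%N) /\
    forall n, ~~ odd n -> forall w : (T n).-tuple bool,
      (run c n w).1 = [::] /\
      output (run c n w).2 =
        [seq (nat_of_ord e.1, nat_of_ord e.2) | e <- edges (G n w)].

Definition coin_prob (R : realType) (T : nat) (A : T.-tuple bool -> Prop) : R :=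
  #|[set w | `[< A w >]]|%:R / (2 ^ T)%:R.

Definition little_o_n (R : realType) (d : nat -> nat) : Prop :=
  forall eta : R, 0 < eta ->
    exists n0, forall n, (n0 <= n)%N -> (d n)%:R <= eta * n%:R.

(* On all large instances G, the minimum of cut_fraction G over bisections is at
   most alpha times the value of every degree-(d n) SOS solution satisfying the
   bisection identity, hence at most alpha times the optimal SOS value. *)
Definition sos_approximates (R : realType) (d : nat -> nat) (alpha : R) : Prop :=
  exists n0, forall n, (n0 <= n)%N -> ~~ odd n ->
  forall G : multigraph n, edges G <> [::] ->
  forall E : {mpoly R[n]} -> R, pseudoexpectation (d n) E ->
    pseudovariance_zero E (bisection_poly R n) 0 ->
    exists2 S : {set 'I_n}, bisection S
      & cut_fraction R G S <= alpha * E (objective_poly R G).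

(* Main.v *)
Require Import Defs.
From HB Require Import structures.
From mathcomp Require Import all_boot all_order all_algebra.
From mathcomp Require Import boolp reals.
From mathcomp Require Import mpoly.
From mathcomp Require exp.
From mathcomp Require Import ring lra zify.

Set Implicit Arguments.
Unset Strict Implicit.
Unset Printing Implicit Defensive.

Import Order.TTheory GRing.Theory Num.Theory.
Local Open Scope ring_scope.

(** Each constraint t is a random 4-tuple of literals, and the graph joins an
    auxiliary vertex w_t to all K copies of each of them.  When the product of
    the four literals is -1 they split 3-1 and the best w_t, their half-sum,
    cuts exactly a quarter of its edges; for independent fair literals the
    optimum cuts 5/16 on average.

    SOS side: the constraint hypergraph is an expander, so Grigoriev's moments
    (E[x_A] = +-1 if A is a sum of at most r constraints, 0 otherwise) define a
    degree-r pseudoexpectation for which every product is -1.  Literals come in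
    opposite pairs, and sending an auxiliary vertex to the half-sum of its
    literals and its twin to minus that makes the bisection identity and the
    objective hold as polynomial identities.

    Cut side: the cost of a constraint is at least 5/4 - e_2/4 + e_4/4, a
    multiaffine function of the averages y in [-1,1] of the four literals over
    their copies; hence its deviation from the mean is extremal at a vertex of
    the cube, where Chernoff and a union bound apply.  A bisection has nearly
    balanced averages because the copies vastly outnumber the other vertices.

    Edges inside one pair of opposite vertices, always cut, raise the SOS value
    from 1/4 to 1/4 + 1/(4c). *)

(** * Moments of a parity system *)

Lemma partial_sign_psd (R : realFieldType) (X : finType) (k : X -> X -> R) :
  (forall x, k x x = 1) -> (forall x y, k x y = k y x) ->
  (forall x y, k x y = 0 \/ k x y ^+ 2 = 1) ->
  (forall x y z, k x y != 0 -> k y z != 0 -> k x z = k x y * k y z) ->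
  forall f : X -> R, 0 <= \sum_x \sum_y f x * f y * k x y.
Proof.
move=> k1 kC kv kM f.
have k2 x y : k x y != 0 -> k x y ^+ 2 = 1.
  by case: (kv x y) => [->|//]; rewrite eqxx.
pose N z : R := \sum_x k x z ^+ 2.
have N_gt0 z : 0 < N z.
  rewrite /N (bigD1 z) //= k1 expr1n ltr_wpDr //.
  by apply: sumr_ge0 => x _; apply: sqr_ge0.
(* [k x y != 0] is an equivalence, on each class of which [k] has rank one; [N z]
   is the size of the class of [z]. *)
have -> : \sum_x \sum_y f x * f y * k x y =
    \sum_z (N z)^-1 * (\sum_x f x * k x z) ^+ 2.
  under [RHS]eq_bigr => z _.
    rewrite expr2 mulr_suml mulr_sumr.
    under eq_bigr => x _ do rewrite mulr_sumr mulr_sumr.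
    over.
  rewrite [RHS]exchange_big; apply: eq_bigr => x _ /=.
  rewrite [RHS]exchange_big; apply: eq_bigr => y _ /=.
  have [kxy0|kxy] := eqVneq (k x y) 0.
    rewrite kxy0 mulr0 big1 // => z _.
    have [->|kxz] := eqVneq (k x z) 0; first by ring.
    have [->|kyz] := eqVneq (k y z) 0; first by ring.
    have := kM x z y kxz; rewrite (kC z y) kyz kxy0 => /(_ isT)/esym/eqP.
    by rewrite mulf_eq0 (negPf kxz) (negPf kyz).
  have Nz z : k x z != 0 -> N z = N x.
    move=> kxz; apply: eq_bigr => t _.
    have [ktx|ktx] := eqVneq (k t x) 0; last first.
      by rewrite (kM _ _ _ ktx kxz) exprMn (k2 _ _ kxz) mulr1.
    rewrite ktx; have [->//|ktz] := eqVneq (k t z) 0.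
    have := kM t z x ktz; rewrite (kC z x) kxz => /(_ isT).
    by rewrite ktx => /esym/eqP; rewrite mulf_eq0 (negPf ktz) (negPf kxz).
  have E z : (N z)^-1 * (f x * k x z * (f y * k y z)) =
             (N x)^-1 * (f x * f y * k x y) * k z x ^+ 2.
    have [kxz0|kxz] := eqVneq (k x z) 0.
      by rewrite (kC z x) kxz0; ring.
    rewrite (Nz _ kxz) (kC z x) k2 // mulr1.
    have kyz : k y z != 0 by rewrite (kM y x z) ?mulf_neq0 // kC.
    rewrite (kM x y z) //.
    transitivity ((N x)^-1 * (f x * f y * k x y) * k y z ^+ 2); first by ring.
    by rewrite k2 // mulr1.
  under eq_bigr => z _ do rewrite E.
  rewrite -mulr_sumr -/(N x); field; exact: lt0r_neq0.
apply: sumr_ge0 => z _; rewrite mulr_ge0 ?sqr_ge0 // invr_ge0; exact: ltW.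
Qed.

Definition sdiff (T : finType) (A B : {set T}) : {set T} :=
  [set v | (v \in A) (+) (v \in B)].

Section SymmetricDifference.
Variable T : finType.
Implicit Types A B C : {set T}.

Lemma in_sdiff v A B : (v \in sdiff A B) = (v \in A) (+) (v \in B).
Proof. by rewrite inE. Qed.

Lemma sdiffC A B : sdiff A B = sdiff B A.
Proof. by apply/setP => v; rewrite !in_sdiff addbC. Qed.

Lemma sdiffA A B C : sdiff A (sdiff B C) = sdiff (sdiff A B) C.
Proof. by apply/setP => v; rewrite !in_sdiff addbA. Qed.

Lemma sdiff0 A : sdiff A set0 = A.
Proof. by apply/setP => v; rewrite in_sdiff in_set0 addbF. Qed.

Lemma sdiffxx A : sdiff A A = set0.
Proof. by apply/setP => v; rewrite in_sdiff in_set0 addbb. Qed.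

Lemma sdiffK A B : sdiff (sdiff A B) B = A.
Proof. by rewrite -sdiffA sdiffxx sdiff0. Qed.

Lemma sdiff_eq0 A B : sdiff A B = set0 -> A = B.
Proof. by move=> E; rewrite -[A](sdiffK _ B) E sdiffC sdiff0. Qed.

Lemma card_sdiff A B : (#|sdiff A B| <= #|A| + #|B|)%N.
Proof.
apply: leq_trans (leq_card_setU A B).1; apply: subset_leq_card.
by apply/subsetP => v; rewrite in_sdiff in_setU; case: (v \in A).
Qed.

End SymmetricDifference.

Section Characters.
Variables (R : realFieldType) (V : finType).
Notation cube := {ffun V -> bool}.
Implicit Types (A B : {set V}) (f g : cube -> R) (x : cube).

Definition chi A x : R := \prod_v (-1) ^+ ((v \in A) && x v).

Lemma chi_sdiff A B x : chi (sdiff A B) x = chi A x * chi B x.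
Proof.
rewrite -big_split /=; apply: eq_bigr => v _.
by rewrite in_sdiff andb_addl signr_addb.
Qed.

Lemma chi0 x : chi set0 x = 1.
Proof. by rewrite /chi big1 // => v _; rewrite in_set0 expr0. Qed.

Lemma chi1 v x : chi [set v] x = (-1) ^+ x v.
Proof.
rewrite /chi (bigD1 v) //= in_set1 eqxx big1 ?mulr1 // => u /negPf uv.
by rewrite in_set1 uv.
Qed.

Lemma chi_sqr A x : chi A x ^+ 2 = 1.
Proof. by rewrite expr2 -chi_sdiff sdiffxx chi0. Qed.

Lemma sum_chi A : \sum_x chi A x = #|cube|%:R * (A == set0)%:R.
Proof.
rewrite /chi -(bigA_distr_bigA (fun v (b : bool) => (-1) ^+ ((v \in A) && b))).
have [->|/set0Pn[v vA]] := eqVneq A set0.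
  under eq_bigr => v _ do rewrite big_bool in_set0 /= expr0.
  rewrite prodr_const card_ffun card_bool natrX mulr1; congr (_ ^+ _); ring.
by rewrite (bigD1 v) //= big_bool vA /= expr0 expr1 addNr mul0r mulr0.
Qed.

Definition hasdeg k f :=
  exists a : {set V} -> R, forall x, f x = \sum_(A : {set V} | (#|A| <= k)%N) a A * chi A x.

Lemma hasdeg_ext k f g : f =1 g -> hasdeg k f -> hasdeg k g.
Proof. by move=> E [a H]; exists a => x; rewrite -E. Qed.

Lemma hasdeg_chi k A : (#|A| <= k)%N -> hasdeg k (chi A).
Proof.
move=> Ak; exists (fun B => (B == A)%:R) => x.
rewrite (bigD1 A) //= eqxx mul1r big1 ?addr0 // => B /andP[_ /negPf->].
by rewrite mul0r.
Qed.

Lemma hasdeg0 k : hasdeg k (fun=> 0).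
Proof. by exists (fun=> 0) => x; rewrite big1 // => A _; rewrite mul0r. Qed.

Lemma hasdeg1 k : hasdeg k (fun=> 1).
Proof.
apply: (hasdeg_ext (f := chi set0)); first exact: chi0.
by apply: hasdeg_chi; rewrite cards0.
Qed.

Lemma hasdegD k f g : hasdeg k f -> hasdeg k g -> hasdeg k (fun x => f x + g x).
Proof.
move=> [a Ha] [b Hb]; exists (fun A => a A + b A) => x.
by rewrite Ha Hb -big_split; apply: eq_bigr => A _; rewrite mulrDl.
Qed.

Lemma hasdegZ k c f : hasdeg k f -> hasdeg k (fun x => c * f x).
Proof.
move=> [a Ha]; exists (fun A => c * a A) => x.
by rewrite Ha mulr_sumr; apply: eq_bigr => A _; rewrite mulrA.
Qed.

Lemma hasdeg_sum k (I : Type) (s : seq I) (P : pred I) (F : I -> cube -> R) :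
  (forall i, P i -> hasdeg k (F i)) -> hasdeg k (fun x => \sum_(i <- s | P i) F i x).
Proof.
move=> H; elim: s => [|i s IH].
  by apply: hasdeg_ext (hasdeg0 k) => x; rewrite big_nil.
case Pi: (P i).
  apply: hasdeg_ext (hasdegD (H i Pi) IH) => x.
  by rewrite big_cons Pi.
by apply: hasdeg_ext IH => x; rewrite big_cons Pi.
Qed.

Lemma hasdeg_le k l f : (k <= l)%N -> hasdeg k f -> hasdeg l f.
Proof.
move=> kl [a Ha]; apply: (@hasdeg_ext _ (fun x => \sum_(A : {set V} | (#|A| <= k)%N) a A * chi A x)).
  by move=> x; rewrite Ha.
apply: hasdeg_sum => A Ak; apply/hasdegZ/hasdeg_chi; exact: leq_trans kl.
Qed.

Lemma hasdegM k l f g :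
  hasdeg k f -> hasdeg l g -> hasdeg (k + l) (fun x => f x * g x).
Proof.
move=> [a Ha] [b Hb].
apply: (@hasdeg_ext _ (fun x => \sum_(A : {set V} | (#|A| <= k)%N) \sum_(B : {set V} | (#|B| <= l)%N)
   (a A * b B) * chi (sdiff A B) x)).
  move=> x; rewrite Ha Hb mulr_suml; apply: eq_bigr => A _.
  rewrite mulr_sumr; apply: eq_bigr => B _; rewrite chi_sdiff; ring.
apply: hasdeg_sum => A Ak; apply: hasdeg_sum => B Bl.
apply/hasdegZ/hasdeg_chi; apply: leq_trans (card_sdiff _ _) _; exact: leq_add.
Qed.

Lemma hasdegX k e f : hasdeg k f -> hasdeg (k * e) (fun x => f x ^+ e).
Proof.
move=> H; elim: e => [|e IH]; first by rewrite muln0; exact: hasdeg1.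
rewrite mulnS; apply: hasdeg_ext (hasdegM H IH) => x; by rewrite exprS.
Qed.

Lemma hasdeg_meval n (u : 'I_n -> cube -> R) d (q : {mpoly R[n]}) :
  (forall v, hasdeg 1 (u v)) -> (msize q <= d.+1)%N ->
  hasdeg d (fun x => q.@[fun v => u v x]).
Proof.
move=> Hu Hq.
apply: (@hasdeg_ext _
  (fun x => \sum_(m <- msupp q | m \in msupp q) q@_m * \prod_i u i x ^+ m i)).
  by move=> x; rewrite mevalE -big_seq.
apply: hasdeg_sum => m mq; apply: hasdegZ.
apply: (@hasdeg_le (mdeg m)).
  by have := leq_trans (msize_mdeg_lt mq) Hq; rewrite ltnS.
rewrite mdegE; elim: (index_enum _) => [|i s IH].
  by rewrite big_nil; apply: hasdeg_ext (hasdeg1 0) => x; rewrite big_nil.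
have := hasdegM (hasdegX (m i) (Hu i)) IH.
by rewrite mul1n big_cons; apply: hasdeg_ext => x; rewrite big_cons.
Qed.

End Characters.

Section Lifting.
Variables (R : realType) (V : finType) (d : nat) (L : ({ffun V -> bool} -> R) -> R).
Hypotheses (L_lin : forall a f g, L (fun x => a * f x + g x) = a * L f + L g)
  (L_ext : forall f g, f =1 g -> L f = L g)
  (L1 : L (fun=> 1) = 1)
  (L_psd : forall f, hasdeg d./2 f -> 0 <= L (fun x => f x ^+ 2)).
Variables (n : nat) (u : 'I_n -> {ffun V -> bool} -> R).
Hypotheses (u_deg : forall v, hasdeg 1 (u v))
  (u_sqr : forall v f, hasdeg (d - 2) f -> (2 <= d)%N ->
     L (fun x => u v x ^+ 2 * f x) = L f).

Definition lift (q : {mpoly R[n]}) : R := L (fun x => q.@[fun v => u v x]).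

Lemma lift_const q b : (forall x, q.@[fun v => u v x] = b) ->
  pseudovariance_zero lift q b.
Proof.
have Lc a : L (fun=> a) = a.
  rewrite -[RHS]mulr1 -L1.
  have L0 : L (fun=> 0) = 0.
    have := L_lin 1 (fun=> 0) (fun=> 0).
    rewrite (@L_ext _ (fun=> 0)); last by move=> x; rewrite mulr0 addr0.
    lra.
  rewrite -[RHS]addr0 -[in RHS]L0 -L_lin; apply: L_ext => x; by rewrite mulr1 addr0.
move=> H; split; rewrite /lift.
  by rewrite -[RHS]Lc; apply: L_ext.
by rewrite -[RHS]Lc; apply: L_ext => x; rewrite rmorphXn /= H.
Qed.

Lemma pseudoexpectation_lift : pseudoexpectation d lift.
Proof.
split=> [a p q _ _||v p Hp|q Hq]; rewrite /lift.
- by rewrite -L_lin; apply: L_ext => x; rewrite mevalD mevalZ.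
- by rewrite -[RHS]L1; apply: L_ext => x; rewrite meval1.
- have [->|p0] := eqVneq p 0; first by rewrite mulr0.
  move: Hp; rewrite /degree_le.
  have X0 : ('X_v : {mpoly R[n]}) != 0 by rewrite -msize_poly_eq0 msizeX mdeg1.
  have sX : msize ('X_v ^+ 2 : {mpoly R[n]}) = 3%N.
    by rewrite mpolyXn msizeX mdegMn mdeg1.
  rewrite msizeM ?expf_neq0 // sX addSn /= => Hp.
  have p1 : (0 < msize p)%N by rewrite lt0n msize_poly_eq0.
  have d2 : (2 <= d)%N by exact: leq_trans (leq_add (leqnn 2) p1) Hp.
  rewrite -[RHS](@u_sqr v) //; last first.
    apply: hasdeg_meval => //; rewrite -subSn // leq_subRL //.
    exact: leqW.
  by apply: L_ext => x; rewrite mevalM rmorphXn /= mevalXU.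
- have := L_psd (hasdeg_meval u_deg Hq); congr (_ <= _); apply: L_ext => x.
  by rewrite rmorphXn.
Qed.

End Lifting.

Notation q0 := (@Ordinal 4 0 isT).
Notation q1 := (@Ordinal 4 1 isT).
Notation q2 := (@Ordinal 4 2 isT).
Notation q3 := (@Ordinal 4 3 isT).

Lemma big_ord4 (T : Type) (idx : T) (op : Monoid.law idx) (F : 'I_4 -> T) :
  \big[op/idx]_i F i = op (F q0) (op (F q1) (op (F q2) (F q3))).
Proof.
rewrite !big_ord_recl big_ord0 Monoid.mulm1.
by congr (op (F _) (op (F _) (op (F _) (F _)))); apply: val_inj.
Qed.

Lemma ord4P (P : 'I_4 -> Prop) : P q0 -> P q1 -> P q2 -> P q3 -> forall i, P i.
Proof.
move=> H0 H1 H2 H3 [[|[|[|[|k]]]] Hk] //.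
- by rewrite (_ : Ordinal _ = q0) //; apply: val_inj.
- by rewrite (_ : Ordinal _ = q1) //; apply: val_inj.
- by rewrite (_ : Ordinal _ = q2) //; apply: val_inj.
- by rewrite (_ : Ordinal _ = q3) //; apply: val_inj.
Qed.

Section ParityLowerBound.
Variables (R : realFieldType) (V I : finType) (a : I -> 'I_4 -> V) (s : I -> 'I_4 -> bool).
Hypothesis a_inj : forall t, injective (a t).
Notation cube := {ffun V -> bool}.
Implicit Types (S T : {set I}) (A B : {set V}) (x : cube).

Definition supp t : {set V} := [set a t i | i : 'I_4].

Definition osum S : {set V} :=
  [set v | \big[addb/false]_(t in S) (v \in supp t)].

Variable r : nat.
Hypothesis r_gt0 : (0 < r)%N.
Hypothesis expanding : forall S, S != set0 -> (#|S| <= r.*2)%N -> (#|S| <= #|osum S|)%N.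

Definition lit t i x : R := (-1) ^+ (x (a t i) (+) s t i).

Definition csign t : R := - \prod_i (-1) ^+ s t i.

Definition ssign S : R := \prod_(t in S) csign t.

Definition moment A : R := \sum_(S : {set I} | (#|S| <= r)%N && (osum S == A)) ssign S.

Definition pmean (f : cube -> R) : R :=
  #|cube|%:R^-1 * \sum_x f x * \sum_(A : {set V}) moment A * chi R A x.

Lemma osum_sdiff S T : osum (sdiff S T) = sdiff (osum S) (osum T).
Proof.
apply/setP => v; rewrite !inE (big_mkcond (fun t => t \in sdiff S T)).
rewrite (big_mkcond (fun t => t \in S)) (big_mkcond (fun t => t \in T)) -big_split /=.
by apply: eq_bigr => t _; rewrite in_sdiff; case: (t \in S); case: (t \in T);
  rewrite /= ?addbF ?addbb.
Qed.

Lemma osum1 t : osum [set t] = supp t.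
Proof. by apply/setP => v; rewrite inE big_set1. Qed.

Lemma osum0 : osum set0 = set0.
Proof. by apply/setP => v; rewrite !inE big_set0. Qed.

Lemma osum_card_le S : (#|S| <= r.*2)%N -> (#|osum S| <= r)%N -> (#|S| <= r)%N.
Proof.
move=> S2 oS; have [->|S0] := eqVneq S set0; first by rewrite cards0.
exact: leq_trans (expanding S0 S2) oS.
Qed.

Lemma osum_inj S T : (#|S| <= r)%N -> (#|T| <= r)%N -> osum S = osum T -> S = T.
Proof.
move=> Sr Tr E; apply: sdiff_eq0; apply/eqP; apply: contraT => ST0.
have := expanding ST0; rewrite osum_sdiff E sdiffxx cards0 leqn0.
rewrite cards_eq0 (negPf ST0) => -> //.
by apply: leq_trans (card_sdiff _ _) _; rewrite -addnn leq_add.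
Qed.

Lemma csign_sqr t : csign t ^+ 2 = 1.
Proof.
rewrite sqrrN -prodrXl big1 // => i _; exact: sqrr_sign.
Qed.

Lemma ssign_sqr S : ssign S ^+ 2 = 1.
Proof. by rewrite -prodrXl big1 // => t _; exact: csign_sqr. Qed.

Lemma ssign_sdiff S T : ssign (sdiff S T) = ssign S * ssign T.
Proof.
rewrite /ssign (big_mkcond (fun t => t \in sdiff S T)).
rewrite (big_mkcond (fun t => t \in S)) (big_mkcond (fun t => t \in T)) -big_split /=.
apply: eq_bigr => t _; rewrite in_sdiff; case: (t \in S); case: (t \in T);
  rewrite /= ?mulr1 ?mul1r // -expr2 csign_sqr //.
Qed.

Lemma moment_osum S : (#|S| <= r)%N -> moment (osum S) = ssign S.
Proof.
move=> Sr; rewrite /moment (big_pred1 S) // => T /=.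
apply/andP/eqP => [[Tr /eqP E]|->]; last by [].
exact: osum_inj.
Qed.

Lemma moment_neq0 A : moment A != 0 -> exists2 S : {set I}, (#|S| <= r)%N & osum S = A.
Proof.
move=> A0; have [S /andP[Sr /eqP SA]|H] := pickP (fun S : {set I} => (#|S| <= r)%N && (osum S == A)).
  by exists S.
by move: A0; rewrite /moment big_pred0 ?eqxx.
Qed.

Lemma moment_set0 : moment set0 = 1.
Proof. by rewrite -osum0 moment_osum ?cards0 // /ssign big_set0. Qed.

Lemma moment_mul A B : (#|sdiff A B| <= r)%N -> moment A != 0 -> moment B != 0 ->
  moment (sdiff A B) = moment A * moment B.
Proof.
move=> AB /moment_neq0[S Sr SA] /moment_neq0[T Tr TB].
rewrite -SA -TB -osum_sdiff in AB *.
rewrite !moment_osum ?ssign_sdiff //; apply: osum_card_le => //.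
by apply: leq_trans (card_sdiff _ _) _; rewrite -addnn leq_add.
Qed.

Lemma moment_shift t A : (#|A| <= r)%N -> (#|sdiff A (supp t)| <= r)%N ->
  moment (sdiff A (supp t)) = csign t * moment A.
Proof.
have half A' : (#|A'| <= r)%N -> (#|sdiff A' (supp t)| <= r)%N -> moment A' != 0 ->
    moment (sdiff A' (supp t)) = csign t * moment A'.
  move=> Ar Ats /moment_neq0[S Sr SA]; rewrite -SA -osum1 -osum_sdiff in Ar Ats *.
  rewrite !moment_osum // ?ssign_sdiff; first by rewrite /ssign big_set1 mulrC.
  apply: osum_card_le => //; apply: leq_trans (card_sdiff _ _) _.
  by rewrite cards1 -addnn leq_add.
move=> Ar Ats; have [A0|] := eqVneq (moment A) 0; last exact: half.
have [->|B0] := eqVneq (moment (sdiff A (supp t))) 0; first by rewrite A0 mulr0.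
have := half _ Ats; rewrite sdiffK => /(_ Ar B0); rewrite A0 => /esym/eqP.
rewrite mulf_eq0 (negPf B0) orbF => /eqP c0.
by have := csign_sqr t; rewrite c0 expr0n => /eqP; rewrite eq_sym oner_eq0.
Qed.

Lemma pmean_lin c f g : pmean (fun x => c * f x + g x) = c * pmean f + pmean g.
Proof.
rewrite /pmean mulrCA -mulrDr; congr (_ * _); rewrite mulr_sumr -big_split /=.
by apply: eq_bigr => x _; rewrite mulrDl mulrA.
Qed.

Lemma pmean_ext f g : f =1 g -> pmean f = pmean g.
Proof. by move=> E; rewrite /pmean; congr (_ * _); apply: eq_bigr => x _; rewrite E. Qed.

Lemma pmeanZ c f : pmean (fun x => c * f x) = c * pmean f.
Proof.
rewrite /pmean mulrCA; congr (_ * _); rewrite mulr_sumr.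
by apply: eq_bigr => x _; rewrite mulrA.
Qed.

Lemma pmean_sum (J : Type) (l : seq J) (P : pred J) (F : J -> cube -> R) :
  pmean (fun x => \sum_(j <- l | P j) F j x) = \sum_(j <- l | P j) pmean (F j).
Proof.
rewrite /pmean -mulr_sumr exchange_big /=; congr (_ * _).
by apply: eq_bigr => x _; rewrite mulr_suml.
Qed.

Lemma pmean_chi A : pmean (chi R A) = moment A.
Proof.
rewrite /pmean; under eq_bigr => x _ do rewrite mulr_sumr.
rewrite exchange_big /= (bigD1 A) //= [X in _ + X]big1 ?addr0 => [|B AB].
  under eq_bigr => x _ do rewrite mulrCA -expr2 chi_sqr mulr1.
  rewrite sumr_const -[X in _ * X]mulr_natl mulrA mulVf ?mul1r // pnatr_eq0 -lt0n.
  by apply/card_gt0P; exists [ffun=> false].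
under eq_bigr => x _ do rewrite mulrCA -chi_sdiff.
rewrite -mulr_sumr sum_chi; case: eqP => [/sdiff_eq0 E|]; last by rewrite !mulr0.
by rewrite E eqxx in AB.
Qed.

Lemma pmean_one : pmean (fun=> 1) = 1.
Proof. by rewrite -(pmean_ext (chi0 R (V := V))) pmean_chi moment_set0. Qed.

Lemma pmean_psd f : hasdeg r./2 f -> 0 <= pmean (fun x => f x ^+ 2).
Proof.
move=> [c Hf].
pose P : {pred {set V}} := fun A => (#|A| <= r./2)%N.
pose X := {A | A \in P}.
pose k (A B : X) := moment (sdiff (val A) (val B)).
have kr (A B : X) : (#|sdiff (val A) (val B)| <= r)%N.
  apply: leq_trans (card_sdiff _ _) _.
  apply: leq_trans (leq_add (valP A) (valP B)) _.
  by rewrite addnn -[X in (_ <= X)%N]odd_double_half leq_addl.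
suff -> : pmean (fun x => f x ^+ 2) = \sum_(A : X) \sum_(B : X) c (val A) * c (val B) * k A B.
  apply: partial_sign_psd.
  - by move=> A; rewrite /k sdiffxx moment_set0.
  - by move=> A B; rewrite /k sdiffC.
  - move=> A B; rewrite /k; have [->|] := eqVneq (moment (sdiff (val A) (val B))) 0; first by left.
    by move=> /moment_neq0[S Sr <-]; right; rewrite (moment_osum Sr) ssign_sqr.
  - move=> A B C AB BC; rewrite /k.
    have E : sdiff (sdiff (val A) (val B)) (sdiff (val B) (val C)) = sdiff (val A) (val C).
      by rewrite sdiffA sdiffK.
    by rewrite -E (moment_mul _ AB BC) // E.
have E x : f x ^+ 2 = \sum_(A : X) \sum_(B : X)
    (c (val A) * c (val B)) * chi R (sdiff (val A) (val B)) x.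
  have -> : f x = \sum_(A : X) c (val A) * chi R (val A) x.
    by rewrite Hf -(big_sub P (fun A => c A * chi R A x)).
  rewrite expr2 mulr_suml; apply: eq_bigr => A _; rewrite mulr_sumr.
  by apply: eq_bigr => B _; rewrite chi_sdiff; ring.
rewrite (pmean_ext E) pmean_sum; apply: eq_bigr => A _.
by rewrite pmean_sum; apply: eq_bigr => B _; rewrite pmeanZ pmean_chi.
Qed.

Lemma lit_chi t i x : lit t i x = (-1) ^+ s t i * chi R [set a t i] x.
Proof. by rewrite chi1 /lit signr_addb mulrC. Qed.

Lemma lit_sqr t i x : lit t i x ^+ 2 = 1.
Proof. exact: sqrr_sign. Qed.

Lemma hasdeg_lit t i : hasdeg 1 (lit t i).
Proof.
apply: (hasdeg_ext (f := fun x => (-1) ^+ s t i * chi R [set a t i] x)).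
  by move=> x; rewrite lit_chi.
by apply/hasdegZ/hasdeg_chi; rewrite cards1.
Qed.

Lemma supp_sdiff t : supp t =
  sdiff (sdiff [set a t q0] [set a t q1]) (sdiff [set a t q2] [set a t q3]).
Proof.
apply/setP => v; rewrite !in_sdiff !in_set1.
have [/imsetP[i _ ->]|vt] := boolP (v \in supp t).
  by rewrite !(inj_eq (@a_inj t)); elim/ord4P: i.
have F i : (v == a t i) = false.
  by apply: contraNF vt => /eqP->; apply: imset_f.
by rewrite !F.
Qed.

Lemma pmean_pair t (i j k l : 'I_4) A : (#|A| <= r - 2)%N -> (2 <= r)%N ->
  supp t = sdiff (sdiff [set a t i] [set a t j]) (sdiff [set a t k] [set a t l]) ->
  csign t = - ((-1) ^+ s t i * (-1) ^+ s t j * ((-1) ^+ s t k * (-1) ^+ s t l)) ->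
  pmean (fun x => lit t i x * lit t j x * chi R A x) =
  - pmean (fun x => lit t k x * lit t l x * chi R A x).
Proof.
move=> Ar r2 St Ct.
have E (p q : 'I_4) : pmean (fun x => lit t p x * lit t q x * chi R A x) =
    (-1) ^+ s t p * (-1) ^+ s t q * moment (sdiff (sdiff [set a t p] [set a t q]) A).
  rewrite -pmean_chi -pmeanZ; apply: pmean_ext => x.
  by rewrite !lit_chi !chi_sdiff; ring.
have C (p q : 'I_4) : (#|sdiff (sdiff [set a t p] [set a t q]) A| <= r)%N.
  apply: leq_trans (card_sdiff _ _) _; rewrite -(subnKC r2) leq_add //.
  by apply: leq_trans (card_sdiff _ _) _; rewrite !cards1.
have S2 : sdiff (sdiff [set a t k] [set a t l]) A =
    sdiff (sdiff (sdiff [set a t i] [set a t j]) A) (supp t).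
  apply/setP => v; rewrite St !in_sdiff.
  by case: (v \in [set a t i]); case: (v \in [set a t j]);
     case: (v \in [set a t k]); case: (v \in [set a t l]); case: (v \in A).
rewrite !E S2 moment_shift // -?S2 //= Ct.
case: (s t i); case: (s t j); case: (s t k); case: (s t l);
  rewrite ?expr0 ?expr1; ring.
Qed.

Definition half_sum t x : R := (\sum_i lit t i x) / 2.

Lemma hasdeg_half_sum t : hasdeg 1 (half_sum t).
Proof.
apply: (hasdeg_ext (f := fun x => 2^-1 * \sum_i lit t i x)).
  by move=> x; rewrite mulrC.
apply: hasdegZ; apply: hasdeg_sum => i _; exact: hasdeg_lit.
Qed.

Lemma pmean_half_sum_sqr t f : hasdeg (r - 2) f -> (2 <= r)%N ->
  pmean (fun x => half_sum t x ^+ 2 * f x) = pmean f.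
Proof.
move=> [c Hf] r2.
rewrite (pmean_ext Hf) pmean_sum.
rewrite (@pmean_ext _ (fun x => \sum_(A : {set V} | (#|A| <= r - 2)%N)
   c A * (half_sum t x ^+ 2 * chi R A x))); last first.
  by move=> x; rewrite Hf mulr_sumr; apply: eq_bigr => A _; rewrite mulrCA.
rewrite pmean_sum; apply: eq_bigr => A Ar; rewrite !pmeanZ; congr (_ * _).
pose g i j x := lit t i x * lit t j x * chi R A x.
rewrite (@pmean_ext _ (fun x => 2^-1 * (g q0 q1 x + (g q2 q3 x + (g q0 q2 x +
   (g q1 q3 x + (g q0 q3 x + g q1 q2 x))))) + chi R A x)); last first.
  move=> x; rewrite /half_sum big_ord4 /g /=.
  have := lit_sqr t q0 x; have := lit_sqr t q1 x.
  have := lit_sqr t q2 x; have := lit_sqr t q3 x.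
  move: (lit t q0 x) (lit t q1 x) (lit t q2 x) (lit t q3 x) => l0 l1 l2 l3 E3 E2 E1 E0.
  transitivity ((4^-1 * (l0 ^+ 2 + l1 ^+ 2 + l2 ^+ 2 + l3 ^+ 2) +
    2^-1 * (l0 * l1 + l2 * l3 + l0 * l2 + l1 * l3 + l0 * l3 + l1 * l2)) * chi R A x).
    by field.
  by rewrite E0 E1 E2 E3; field.
have pmeanD f1 f2 : pmean (fun x => f1 x + f2 x) = pmean f1 + pmean f2.
  by rewrite -[pmean f1]mul1r -pmean_lin; apply: pmean_ext => x; rewrite mul1r.
rewrite pmean_lin !pmeanD /g.
have sA := supp_sdiff t.
have cA : csign t = - ((-1) ^+ s t q0 * (-1) ^+ s t q1 * ((-1) ^+ s t q2 * (-1) ^+ s t q3)).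
  by rewrite /csign big_ord4 /= !mulrA.
rewrite (@pmean_pair t q0 q1 q2 q3) //.
rewrite (@pmean_pair t q0 q2 q1 q3) //; first last.
- by rewrite cA; ring.
- by rewrite sA; apply/setP => v; rewrite !in_sdiff !addbA;
    case: (v \in [set a t q0]); case: (v \in [set a t q1]);
    case: (v \in [set a t q2]); case: (v \in [set a t q3]).
rewrite (@pmean_pair t q0 q3 q1 q2) //; first last.
- by rewrite cA; ring.
- by rewrite sA; apply/setP => v; rewrite !in_sdiff !addbA;
    case: (v \in [set a t q0]); case: (v \in [set a t q1]);
    case: (v \in [set a t q2]); case: (v \in [set a t q3]).
ring.
Qed.

End ParityLowerBound.

(** * Expansion of random constraints *)

Lemma union_bound (T I : finType) (P : pred T) (J : pred I) (Q : I -> pred T) :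
  (forall w, P w -> exists2 i, J i & Q i w) ->
  (#|[set w | P w]| <= \sum_(i | J i) #|[set w | Q i w]|)%N.
Proof.
move=> H; rewrite -sum1dep_card (eq_bigr (fun i => \sum_(w | Q i w) 1)%N); last first.
  by move=> i _; rewrite sum1dep_card.
rewrite (exchange_big_dep predT) //= big_mkcond; apply: leq_sum => w _.
case: ifP => // Pw; have [i Ji Qi] := H w Pw.
by rewrite (bigD1 i) //= Ji Qi.
Qed.

Lemma expn_self_le s : (s ^ s <= 4 ^ s * s`!)%N.
Proof.
apply: (@leq_trans ((s + s) ^_ s)).
  rewrite ffact_prod -[X in (X <= _)%N]/(s ^ s)%N.
  rewrite -[X in (s ^ X)%N](card_ord s) -prod_nat_const.
  by apply: leq_prod => i _; rewrite -addnBA ?leq_addr // ltnW.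
rewrite -bin_ffact leq_mul2r; apply/orP; right.
rewrite (_ : 4 ^ s = 2 ^ (s + s))%N; last by rewrite addnn -mul2n expnM.
rewrite -[2%N]/(1 + 1)%N expnDn.
have ss : (s < (s + s).+1)%N by rewrite ltnS leq_addr.
by rewrite (bigD1 (Ordinal ss)) //= !exp1n !muln1 leq_addr.
Qed.

Lemma bin_exp_le m s : ('C(m, s) * s ^ s <= (4 * m) ^ s)%N.
Proof.
apply: leq_trans (leq_mul (leqnn _) (expn_self_le s)) _.
rewrite mulnCA expnMn leq_mul2l; apply/orP; right.
rewrite bin_ffact ffact_prod -[X in (m ^ X)%N](card_ord s) -prod_nat_const.
by apply: leq_prod => i _; rewrite leq_subr.
Qed.

Lemma sum_geom_bound (R : realFieldType) m :
  \sum_(s < m) s%:R * 2^-1 ^+ s <= 2 :> R.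
Proof.
suff: \sum_(s < m) s%:R * 2^-1 ^+ s = 2 - (m%:R + 1) * 2 * 2^-1 ^+ m :> R.
  move=> ->; rewrite gerBl; apply: mulr_ge0; last by apply: exprn_ge0; rewrite invr_ge0.
  by rewrite mulr_ge0 // addr_ge0.
elim: m => [|m IH]; first by rewrite big_ord0 expr0; ring.
by rewrite big_ord_recr IH /= exprS -natr1; field.
Qed.

Section RandomConstraints.
Variables (M L : nat).
Notation Omega := {ffun 'I_M -> {ffun 'I_4 -> 'I_L}}.
Implicit Types (w : Omega) (S : {set 'I_M}) (U : {set 'I_M * 'I_4}).

Lemma half_ord_subproof (k : 'I_L) : (k./2 < L)%N.
Proof. by apply: leq_ltn_trans (ltn_ord k); rewrite -[leqRHS]odd_double_half -addnn addnA leq_addl. Qed.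

Definition half_ord (k : 'I_L) : 'I_L := Ordinal (half_ord_subproof k).

Lemma odd_ord_subproof (k : 'I_L) : (odd k < L)%N.
Proof. by apply: leq_ltn_trans (ltn_ord k); case: k => -[|k] //= _; case: (odd k). Qed.

Definition odd_ord (k : 'I_L) : 'I_L := Ordinal (odd_ord_subproof k).

(* Literals [2h] and [2h + 1] of a block are the two signs of variable [h]. *)
Definition var w (t : 'I_M) (i : 'I_4) : 'I_4 * 'I_L := (i, half_ord (w t i)).

Lemma var_inj w t : injective (var w t).
Proof. by move=> i j []. Qed.

Lemma half_odd_ord_inj (k l : 'I_L) : half_ord k = half_ord l -> odd_ord k = odd_ord l -> k = l.
Proof.
move=> /(congr1 val) /= Hh /(congr1 val) /= Ho; apply: val_inj => /=.
by rewrite -[val k]odd_double_half -[val l]odd_double_half Hh Ho.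
Qed.

Definition earlier w S (p : 'I_M * 'I_4) : pred 'I_M :=
  [pred t | [&& t \in S, (t < p.1)%N & half_ord (w t p.2) == half_ord (w p.1 p.2)]].

Definition repeats w S : {set 'I_M * 'I_4} :=
  [set p | (p.1 \in S) && [exists t, earlier w S p t]].

Lemma mem_osum w S i h : ((i, h) \in osum (var w) S) =
  odd #|[set t in S | half_ord (w t i) == h]|.
Proof.
rewrite inE -sum1dep_card (big_morph odd oddD (erefl _)) big_mkcondr /=.
apply: eq_bigr => t _; case: eqP => [<-|H].
  by apply/imsetP; exists i.
by apply/negbTE/imsetP => -[j _ [E1 E2]]; apply: H; rewrite E1 E2.
Qed.

Lemma repeats_osum w S : (4 * #|S| <= #|repeats w S|.*2 + #|osum (var w) S|)%N.
Proof.
pose F (v : 'I_4 * 'I_L) := [set t in S | half_ord (w t v.1) == v.2].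
pose G (v : 'I_4 * 'I_L) :=
  [set t in S | (half_ord (w t v.1) == v.2) && [exists t', earlier w S (t, v.1) t']].
have EF : (4 * #|S| = \sum_v #|F v|)%N.
  have -> : (4 * #|S| = #|setX S [set: 'I_4]|)%N by rewrite cardsX cardsT card_ord mulnC.
  rewrite -sum1_card.
  rewrite (partition_big (fun p => (p.2, half_ord (w p.1 p.2))) predT) //=.
  apply: eq_bigr => -[i h] _ /=; rewrite -sum1dep_card sum1dep_card.
  rewrite -(card_imset _ (f := fun t => (t, i))); last by move=> x y [].
  rewrite sum1dep_card; apply: eq_card => -[t j]; rewrite !inE /=.
  apply/idP/imsetP => [/andP[/andP[tS _] /eqP[-> E]]|[t' ]].
    by exists t => //; rewrite inE tS E eqxx.
  by rewrite inE => /andP[tS /eqP E] [-> ->]; rewrite tS E eqxx.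
have EG : (#|repeats w S| = \sum_v #|G v|)%N.
  rewrite -sum1_card.
  rewrite (partition_big (fun p => (p.2, half_ord (w p.1 p.2))) predT) //=.
  apply: eq_bigr => -[i h] _ /=.
  rewrite -(card_imset _ (f := fun t => (t, i))); last by move=> x y [].
  rewrite sum1dep_card; apply: eq_card => -[t j]; rewrite !inE /=.
  apply/idP/imsetP => [/andP[/andP[tS Et] /eqP[<- E]]|[t' ]].
    by exists t => //; rewrite inE tS E eqxx.
  by rewrite inE => /and3P[tS /eqP E Et] [-> ->]; rewrite tS Et E eqxx.
have -> : #|osum (var w) S| = (\sum_v odd #|F v|)%N.
  rewrite -sum1_card big_mkcond; apply: eq_bigr => -[i h] _.
  by rewrite mem_osum /F /=; case: (odd _).
rewrite EF EG -muln2 big_distrl -big_split /=; apply: leq_sum => v _.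
have GF : G v \subset F v.
  by apply/subsetP => t; rewrite !inE => /and3P[-> ->].
have : (#|F v :\: G v| <= 1)%N.
  apply/card_le1P => t; rewrite !inE => /andP[tG tF] t'.
  rewrite !inE; apply/idP/eqP => [/andP[t'G t'F]|->]; last by rewrite tG tF.
  move: tF t'F => /andP[tS /eqP tv] /andP[t'S /eqP t'v].
  move: tG t'G; rewrite tS t'S tv t'v eqxx /= !negb_exists => /forallP/(_ t') H1.
  move=> /forallP/(_ t); move: H1; rewrite /earlier /=.
  rewrite tS t'S tv t'v eqxx !andbT /= -!leqNgt => H1 H2.
  by apply: val_inj; apply/eqP; rewrite eqn_leq H1 H2.
rewrite cardsD (setIidPr GF); move: (subset_leq_card GF).
move: #|F v| #|G v| => x y; case: (boolP (odd x)) => ox; last lia.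
lia.
Qed.

(* A repeated variable is determined by its sign and the earlier constraint where
   it occurs, which leaves [2 * #|S|] choices instead of [L]. *)
Definition encode w S U : {ffun 'I_M * 'I_4 -> 'I_M * 'I_L} :=
  [ffun p => if p \in U then (odflt p.1 [pick t | earlier w S p t], odd_ord (w p.1 p.2))
             else (p.1, w p.1 p.2)].

Lemma encode_inj S U : {in [set w | repeats w S == U] &, injective (fun w => encode w S U)}.
Proof.
move=> w w'; rewrite !inE => /eqP rw /eqP rw' E.
suff H m (t : 'I_M) i : (t < m)%N -> w t i = w' t i.
  by apply/ffunP => t; apply/ffunP => i; apply: (H M).
elim: m t i => // m IH t i tm.
have := congr1 (fun f : {ffun _} => f (t, i)) E; rewrite !ffunE /=.
case: ifP => [tU|_ [] //] [].
have: (t, i) \in repeats w S by rewrite rw.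
rewrite inE => /andP[tS /existsP/= [u Hu]].
have: (t, i) \in repeats w' S by rewrite rw'.
rewrite inE => /andP[_ /existsP/= [u' Hu']].
case: pickP => [x Hx|/(_ u)]; last by rewrite Hu.
case: pickP => [x' Hx'|/(_ u')]; last by rewrite Hu'.
move=> /= Exx O; rewrite -Exx in Hx'.
move: Hx Hx' => /and3P[_ xt /eqP Ex] /and3P[_ _ /eqP Ex'].
apply: half_odd_ord_inj; last exact: val_inj.
by rewrite -Ex -Ex' (IH x) //; apply: leq_trans xt _.
Qed.

Lemma card_repeats S U : U \subset [set p | p.1 \in S] ->
  (#|[set w | repeats w S == U]| <= (2 * #|S|) ^ #|U| * L ^ (4 * M - #|U|))%N.
Proof.
move=> US; rewrite -(card_in_imset (@encode_inj S U)).
pose F (p : 'I_M * 'I_4) : {set 'I_M * 'I_L} :=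
  if p \in U then setX S [set k : 'I_L | (k < 2)%N] else setX [set p.1] setT.
apply: (@leq_trans #|family F|).
  apply: subset_leq_card; apply/subsetP => _ /imsetP[w rw ->].
  apply/familyP => p; rewrite ffunE /F; case: ifP => pU; last first.
    by rewrite in_setX in_set1 eqxx in_setT.
  move: rw; rewrite inE => /eqP rw; rewrite -rw inE in pU.
  case/andP: pU => pS /existsP[u Hu].
  case: pickP => [x Hx|/(_ u)]; last by rewrite Hu.
  by rewrite in_setX inE /=; case/and3P: Hx => -> _ _ /=; case: odd.
rewrite card_family foldrE big_map big_enum /=.
have -> : ((2 * #|S|) ^ #|U| * L ^ (4 * M - #|U|) =
    \prod_(p : 'I_M * 'I_4) if p \in U then 2 * #|S| else L)%N.
  rewrite (bigID (fun p => p \in U)) /=; congr (_ * _)%N.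
    by rewrite -prod_nat_const; apply: eq_bigr => p ->.
  rewrite (eq_bigr (fun=> L)); last by move=> p /negPf->.
  rewrite prod_nat_const; congr (_ ^ _)%N.
  have := cardC (mem U); rewrite card_prod !card_ord mulnC => <-.
  by rewrite addKn; apply: eq_card.
apply: leq_prod => p _; rewrite /F; case: ifP => pU; rewrite cardsX.
  rewrite mulnC leq_mul2r; apply/orP; right.
  rewrite -[leqRHS](card_ord 2); apply: (@leq_card_in _ _ (fun k : 'I_L => inord k)).
  move=> k l; rewrite !inE => k2 l2 /(congr1 val) /=.
  by rewrite !inordK // => kl; apply: val_inj.
by rewrite cards1 mul1n cardsT card_ord.
Qed.

Lemma card_Omega : #|Omega| = (L ^ (4 * M))%N.
Proof. by rewrite !card_ffun !card_ord -expnM. Qed.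

Lemma card_small_osum (R : rcfType) S (q : R) : (0 < L)%N -> 0 <= q -> q <= 1 ->
  q ^+ 2 = (2 * #|S|)%:R / L%:R ->
  #|[set w | (#|osum (var w) S| < #|S|)%N]|%:R <=
    #|Omega|%:R * 16 ^+ #|S| * q ^+ (3 * #|S|).
Proof.
move=> L0 q0 q1 q2.
pose J (U : {set 'I_M * 'I_4}) :=
  (U \in powerset [set p | p.1 \in S]) && (3 * #|S| < #|U|.*2)%N.
have H w : (#|osum (var w) S| < #|S|)%N ->
    exists2 U, J U & repeats w S == U.
  move=> oS; exists (repeats w S); rewrite // /J powersetE; apply/andP; split.
    by apply/subsetP => p; rewrite !inE => /andP[].
  have := repeats_osum w S; lia.
have := union_bound H; rewrite -(ler_nat R) => /le_trans; apply.
have Lr : L%:R != 0 :> R by rewrite pnatr_eq0 -lt0n.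
have cU U : J U -> #|[set w | repeats w S == U]|%:R <= #|Omega|%:R * q ^+ (3 * #|S|).
  move=> /andP[]; rewrite powersetE => US U3.
  have UM : (#|U| <= 4 * M)%N.
    by apply: leq_trans (max_card _) _; rewrite card_prod !card_ord mulnC.
  have := card_repeats US; rewrite -(ler_nat R) => /le_trans; apply.
  rewrite card_Omega natrM !natrX -{2}(subnK UM) exprD mulrC -mulrA.
  apply: ler_wpM2l; first by rewrite exprn_ge0.
  rewrite (_ : (2 * #|S|)%:R = L%:R * q ^+ 2) ?exprMn; last by rewrite q2; field.
  apply: ler_wpM2l; first by rewrite exprn_ge0.
  rewrite -exprD addnn; apply: ler_wiXn2l => //.
  exact: ltnW.
rewrite natr_sum; apply: le_trans (ler_sum _ cU) _.
rewrite sumr_const -[leLHS]mulr_natr mulrAC.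
apply: ler_wpM2r; first exact: exprn_ge0.
apply: ler_wpM2l => //.
rewrite -natrX ler_nat.
apply: (@leq_trans #|powerset [set p : 'I_M * 'I_4 | p.1 \in S]|).
  by apply: subset_leq_card; apply/subsetP => U /andP[].
rewrite card_powerset (_ : [set p | _] = setX S [set: 'I_4]); last first.
  by apply/setP => p; rewrite !inE andbT.
by rewrite cardsX cardsT card_ord mulnC expnM.
Qed.

Definition nonexpanding r w : bool :=
  [exists S : {set 'I_M}, [&& S != set0, (#|S| <= r.*2)%N & (#|osum (var w) S| < #|S|)%N]].

Lemma card_nonexpanding (R : rcfType) (D r : nat) : (0 < L)%N -> (0 < D)%N ->
  M = (D * L)%N -> (16 * (128 * D) ^ 2 * r <= L)%N ->
  #|[set w | nonexpanding r w]|%:R <=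
    #|Omega|%:R * (4 * (128 * D)%:R * Num.sqrt (2 / L%:R)) :> R.
Proof.
move=> L0 D0 ML rL; set B := (128 * D)%N.
have Lr : 0 < L%:R :> R by rewrite ltr0n.
have B0 : 0 < B%:R :> R by rewrite ltr0n muln_gt0.
pose J (S : {set 'I_M}) := (0 < #|S| < r.*2.+1)%N.
have H w : nonexpanding r w -> exists2 S, J S & (#|osum (var w) S| < #|S|)%N.
  move=> /existsP[S /and3P[S0 Sr oS]]; exists S => //.
  by rewrite /J card_gt0 S0 ltnS.
have := union_bound H; rewrite -(ler_nat R) natr_sum => /le_trans; apply.
pose q (s : nat) : R := Num.sqrt ((2 * s)%:R / L%:R).
have q0 s : 0 <= q s by exact: sqrtr_ge0.
have q2 s : q s ^+ 2 = (2 * s)%:R / L%:R by rewrite sqr_sqrtr // divr_ge0.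
have qB s : (s <= r.*2)%N -> B%:R * q s <= 2^-1.
  move=> sr; rewrite -(ler_pXn2r (n := 2)) ?nnegrE ?mulr_ge0 ?invr_ge0 //.
  rewrite exprMn q2 mulrA ler_pdivrMr // -natrX -natrM.
  rewrite (_ : 2^-1 ^+ 2 * L%:R = L%:R / 4); last by field.
  rewrite ler_pdivlMr // -[4]/(4%:R) -natrM ler_nat; apply: leq_trans rL.
  rewrite -/B -!mulnA; have : (s * 8 <= r * 16)%N by lia.
  move: (B ^ 2)%N => x; nia.
have q1 s : (s <= r.*2)%N -> q s <= 1.
  move=> /qB; have := q0 s; have : 1 <= B%:R :> R by rewrite ler1n muln_gt0.
  nra.
apply: (@le_trans _ _ (\sum_(S | J S) #|Omega|%:R * 16 ^+ #|S| * q #|S| ^+ (3 * #|S|))).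
  by apply: ler_sum => S /andP[_ Sr]; apply: card_small_osum => //; exact: q1.
rewrite (partition_big (fun S : {set 'I_M} => inord #|S| : 'I_(r.*2.+1)) predT) //=.
apply: (@le_trans _ _ (\sum_(s < r.*2.+1)
    #|Omega|%:R * (2 * B%:R * Num.sqrt (2 / L%:R) * (s%:R * 2^-1 ^+ s)))); last first.
  rewrite -mulr_sumr ler_wpM2l // -mulr_sumr.
  rewrite (_ : 4 * _ * _ = 2 * B%:R * Num.sqrt (2 / L%:R) * 2); last by ring.
  rewrite ler_wpM2l ?sum_geom_bound // !mulr_ge0 // ?sqrtr_ge0 //.
apply: ler_sum => s _; have sr : (s <= r.*2)%N by rewrite -ltnS.
case: (posnP s) => [s0|s0].
  rewrite big1; first by rewrite s0 mul0r !mulr0.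
  move=> S /andP[/andP[S0 Sr] /eqP E]; move: S0.
  by rewrite -[#|S|](inordK Sr) E s0.
apply: (@le_trans _ _ (\sum_(S : {set 'I_M} | #|S| == s) #|Omega|%:R * 16 ^+ s * q s ^+ (3 * s))).
  rewrite big_mkcond [leRHS]big_mkcond; apply: ler_sum => S _.
  case: ifP => [/andP[/andP[S0 Sr] /eqP E]|_]; last first.
    by case: ifP => // _; rewrite !mulr_ge0 // ?exprn_ge0.
  have -> : #|S| = s by rewrite -[#|S|](inordK Sr) E.
  by rewrite eqxx.
rewrite sumr_const -[X in X <= _]mulr_natl -!mulrA mulrCA ler_wpM2l //.
rewrite (_ : #|_| = 'C(M, s)); last first.
  by rewrite -[M in RHS]card_ord -card_draws -sum1dep_card -sum1_card.
have C1 : 'C(M, s)%:R * (16 ^+ s * q s ^+ (3 * s)) <= (B%:R * q s) ^+ s.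
  have sR : 0 < s%:R ^+ s :> R by rewrite exprn_gt0 // ltr0n.
  have Cs : 'C(M, s)%:R * s%:R ^+ s <= (4 * M)%:R ^+ s :> R.
    by rewrite -!natrX -natrM ler_nat bin_exp_le.
  rewrite -(ler_pM2r sR) mulrAC.
  apply: le_trans (ler_wpM2r _ Cs) _; first by rewrite mulr_ge0 ?exprn_ge0.
  rewrite exprM -!exprMn ler_pXn2r ?nnegrE ?mulr_ge0 ?exprn_ge0 //.
  rewrite exprSr q2 ML /B !natrM le_eqVlt; apply/orP; left; apply/eqP; field.
  by rewrite lt0r_neq0.
apply: le_trans C1 _.
have -> : (B%:R * q s) ^+ s = B%:R * q s * (B%:R * q s) ^+ s.-1.
  by rewrite -exprS prednK.
have qs : q s <= Num.sqrt (2 / L%:R) * s%:R.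
  rewrite -(ler_pXn2r (n := 2)) ?nnegrE ?mulr_ge0 ?sqrtr_ge0 //.
  rewrite q2 exprMn sqr_sqrtr ?divr_ge0 // natrM mulrAC ler_wpM2l ?divr_ge0 //.
  by rewrite -natrX ler_nat -[leqLHS]muln1 leq_mul2l s0 orbT.
have -> : 2^-1 ^+ s = 2^-1 * 2^-1 ^+ s.-1 :> R by rewrite -exprS prednK.
have -> : 2 * (B%:R * (Num.sqrt (2 / L%:R) * (s%:R * (2^-1 * 2^-1 ^+ s.-1)))) =
    B%:R * (Num.sqrt (2 / L%:R) * s%:R) * 2^-1 ^+ s.-1 :> R by field.
apply: ler_pM => //; rewrite ?mulr_ge0 ?exprn_ge0 ?mulr_ge0 //.
  by rewrite ler_wpM2l.
by rewrite lerXn2r ?nnegrE ?mulr_ge0 ?invr_ge0 // qB.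
Qed.

End RandomConstraints.

(** * Cost of a random instance *)

Definition quad (R : realFieldType) (y : 'I_4 -> R) : R :=
  5 / 4 - (y q0 * y q1 + y q2 * y q3 + y q0 * y q2 + y q1 * y q3 + y q0 * y q3 + y q1 * y q2) / 4
  + y q0 * y q1 * y q2 * y q3 / 4.

Lemma affine_ge0 (R : realFieldType) (a b y : R) :
  -1 <= y <= 1 -> 0 <= a + b -> 0 <= a - b -> 0 <= a + b * y.
Proof. by move=> /andP[? ?] ? ?; nra. Qed.

Lemma itv_mul (R : realFieldType) (x y : R) :
  -1 <= x <= 1 -> -1 <= y <= 1 -> -1 <= x * y <= 1.
Proof. by rewrite -!ler_norml normrM => ? ?; apply: mulr_ile1. Qed.

Lemma quad_le (R : realFieldType) (y : 'I_4 -> R) (z : bool) :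
  (forall i, -1 <= y i <= 1) -> quad y <= 2 - (-1) ^+ z * (\sum_i y i) / 2.
Proof.
move=> Hy; rewrite big_ord4 /quad -subr_ge0 /=.
move: (Hy q0) (Hy q1) (Hy q2) (Hy q3).
move: (y q0) (y q1) (y q2) (y q3) => a b c d Ha Hb Hc Hd.
have V1 (s u v : R) : s ^+ 2 = 1 -> u ^+ 2 = 1 -> v ^+ 2 = 1 ->
    0 <= 3 / 4 - (-1) ^+ z * (s + u + v + d) / 2 +
     (s * u + s * v + u * v + (s + u + v) * d) / 4 - s * u * v * d / 4.
  have F (x : R) : x ^+ 2 = 1 -> x = 1 \/ x = -1.
    by move=> /eqP; rewrite sqrf_eq1 => /orP[]/eqP; tauto.
  by move=> /F[]-> /F[]-> /F[]->; case: z; rewrite ?expr0 ?expr1; lra.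
have sq1 : (1 : R) ^+ 2 = 1 by rewrite expr1n.
have sqm : (-1 : R) ^+ 2 = 1 by rewrite sqrrN expr1n.
have V2 (s u : R) : s ^+ 2 = 1 -> u ^+ 2 = 1 ->
    0 <= 3 / 4 - (-1) ^+ z * (s + u + c + d) / 2 +
     (s * u + s * c + u * c + (s + u + c) * d) / 4 - s * u * c * d / 4.
  move=> Hs Hu; rewrite [X in 0 <= X](_ : _ =
   (3 / 4 - (-1) ^+ z * (s + u + d) / 2 + (s * u + (s + u) * d) / 4) +
   (- (-1) ^+ z / 2 + (s + u + d) / 4 - s * u * d / 4) * c); last by ring.
  apply: affine_ge0 => //.
    by have := V1 s u 1 Hs Hu sq1; congr (_ <= _); ring.
  by have := V1 s u (-1) Hs Hu sqm; congr (_ <= _); ring.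
have V3 (s : R) : s ^+ 2 = 1 ->
    0 <= 3 / 4 - (-1) ^+ z * (s + b + c + d) / 2 +
     (s * b + s * c + b * c + (s + b + c) * d) / 4 - s * b * c * d / 4.
  move=> Hs; rewrite [X in 0 <= X](_ : _ =
   (3 / 4 - (-1) ^+ z * (s + c + d) / 2 + (s * c + (s + c) * d) / 4) +
   (- (-1) ^+ z / 2 + (s + c + d) / 4 - s * c * d / 4) * b); last by ring.
  apply: affine_ge0 => //.
    by have := V2 s 1 Hs sq1; congr (_ <= _); ring.
  by have := V2 s (-1) Hs sqm; congr (_ <= _); ring.
rewrite [X in 0 <= X](_ : _ =
   (3 / 4 - (-1) ^+ z * (b + c + d) / 2 + (b * c + (b + c) * d) / 4) +
   (- (-1) ^+ z / 2 + (b + c + d) / 4 - b * c * d / 4) * a); last by field.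
apply: affine_ge0 => //.
  by have := V3 1 sq1; congr (_ <= _); ring.
by have := V3 (-1) sqm; congr (_ <= _); ring.
Qed.

Lemma quad_ge (R : realFieldType) (y : 'I_4 -> R) :
  (forall i, -1 <= y i <= 1) -> 5 / 4 - (\sum_i y i) ^+ 2 / 8 <= quad y.
Proof.
move=> Hy; rewrite big_ord4 /quad -subr_ge0 /=.
move: (Hy q0) (Hy q1) (Hy q2) (Hy q3).
move: (y q0) (y q1) (y q2) (y q3) => a b c d Ha Hb Hc Hd.
have Hcd : -1 <= c * d <= 1.
  exact: itv_mul.
have Hp : 0 <= (a ^+ 2 + b ^+ 2) / 2 + (a * b) * (c * d).
  apply: affine_ge0 => //; first by have := sqr_ge0 (a + b); lra.
  by have := sqr_ge0 (a - b); lra.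
have := sqr_ge0 c; have := sqr_ge0 d; move: Hp.
rewrite [X in 0 <= X -> _](_ : _ = (a ^+ 2 + b ^+ 2) / 2 + a * b * c * d); last by ring.
by rewrite !expr2; lra.
Qed.

Lemma quad_abs_le (R : realFieldType) (y : 'I_4 -> R) :
  (forall i, -1 <= y i <= 1) -> -3 <= quad y <= 3.
Proof.
move=> Hy; rewrite /quad.
have H := @itv_mul R.
have H4 := H _ _ (H _ _ (H _ _ (Hy q0) (Hy q1)) (Hy q2)) (Hy q3).
move: H4 (H _ _ (Hy q0) (Hy q1)) (H _ _ (Hy q2) (Hy q3)) (H _ _ (Hy q0) (Hy q2))
 (H _ _ (Hy q1) (Hy q3)) (H _ _ (Hy q0) (Hy q3)) (H _ _ (Hy q1) (Hy q2)).
by move=> /andP[? ?] /andP[? ?] /andP[? ?] /andP[? ?] /andP[? ?] /andP[? ?] /andP[? ?];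
  apply/andP; split; lra.
Qed.

Lemma quad_affine (R : realFieldType) (y yp ym : 'I_4 -> R) (v : R) i :
  (forall j, j != i -> y j = yp j /\ ym j = yp j) ->
  y i = (1 + v) / 2 * yp i + (1 - v) / 2 * ym i ->
  quad y = (1 + v) / 2 * quad yp + (1 - v) / 2 * quad ym.
Proof.
elim/ord4P: i => H E; rewrite /quad E.
- by case: (H q1 isT) (H q2 isT) (H q3 isT) => -> -> [-> ->] [-> ->]; field.
- by case: (H q0 isT) (H q2 isT) (H q3 isT) => -> -> [-> ->] [-> ->]; field.
- by case: (H q0 isT) (H q1 isT) (H q3 isT) => -> -> [-> ->] [-> ->]; field.
- by case: (H q0 isT) (H q1 isT) (H q2 isT) => -> -> [-> ->] [-> ->]; field.
Qed.

Section MultiAffine.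
Variables (R : realFieldType) (I : finType).

Definition upd (y : {ffun I -> R}) p v : {ffun I -> R} :=
  [ffun p' => if p' == p then v else y p'].

Lemma multiaffine_min (f : {ffun I -> R} -> R) :
  (forall y p v, f (upd y p v) = (1 + v) / 2 * f (upd y p 1) + (1 - v) / 2 * f (upd y p (-1))) ->
  forall y : {ffun I -> R}, (forall p, -1 <= y p <= 1) ->
  exists b : {ffun I -> bool}, f [ffun p => (-1) ^+ b p] <= f y.
Proof.
move=> Hf y Hy.
suff [y' [H1 H2 H3]] : exists y' : {ffun I -> R},
    [/\ forall p, p \in enum I -> exists b : bool, y' p = (-1) ^+ b,
        forall p, -1 <= y' p <= 1 & f y' <= f y].
  exists [ffun p => y' p == -1]; rewrite (_ : [ffun p => _] = y') //.
  apply/ffunP => p; rewrite !ffunE.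
  case: (H1 p (mem_enum I p)) => -[] ->; rewrite ?expr1 ?expr0 ?eqxx //.
  by case: eqP => // /eqP; rewrite -subr_eq0 opprK -natrD pnatr_eq0.
elim: (enum I) => [|p s [y' [H1 H2 H3]]]; first by exists y; split.
have E : y' = upd y' p (y' p).
  by apply/ffunP => p'; rewrite ffunE; case: eqP => // ->.
have := Hf y' p (y' p); rewrite -E => Ey.
have [b Hb] : exists b : bool, f (upd y' p ((-1) ^+ b)) <= f y'.
  have /andP[l1 l2] := H2 p.
  case: (leP (f (upd y' p 1)) (f (upd y' p (-1)))) => H.
    by exists false; rewrite expr0 Ey; nra.
  by exists true; rewrite expr1 Ey; nra.
exists (upd y' p ((-1) ^+ b)); split; last exact: le_trans H3.
  move=> p'; rewrite inE ffunE; case: eqP => [_ _|_ /=]; first by exists b.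
  exact: H1.
move=> p'; rewrite ffunE; case: eqP => // _.
by case: b {Hb}; rewrite ?expr0 ?expr1; lra.
Qed.

End MultiAffine.

Section Chernoff.
Variable R : realType.
Notation expR := sequences.expR.

Lemma expR_quadratic_bound (z : R) : -2^-1 <= z <= 2^-1 -> expR z <= 1 + z + 2 * z ^+ 2.
Proof.
move=> /andP[z1 z2].
have H : expR (- z) * (1 + z + 2 * z ^+ 2) >= 1.
  apply: (@le_trans _ _ ((1 - z) * (1 + z + 2 * z ^+ 2))); first nra.
  by apply: ler_wpM2r; [nra | exact: exp.expR_ge1Dx].
rewrite -[leLHS]mulr1; apply: le_trans (ler_wpM2l _ H) _; first exact/ltW/exp.expR_gt0.
by rewrite mulrA -exp.expRD subrr exp.expR0 mul1r.
Qed.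

Lemma expR_sum (I : Type) (s : seq I) (F : I -> R) :
  expR (\sum_(i <- s) F i) = \prod_(i <- s) expR (F i).
Proof.
elim: s => [|i s IH]; first by rewrite !big_nil exp.expR0.
by rewrite !big_cons exp.expRD IH.
Qed.

Lemma expR_nat n (x : R) : expR (n%:R * x) = expR x ^+ n.
Proof.
elim: n => [|n IH]; first by rewrite mul0r exp.expR0.
by rewrite -natr1 mulrDl mul1r exp.expRD IH exprSr.
Qed.

Lemma chernoff (T : finType) (M : nat) (Z : T -> R) (B tau : R) :
  \sum_x Z x = 0 -> (forall x, -B <= Z x <= B) -> 0 < B -> 0 <= tau <= B ->
  #|[set w : {ffun 'I_M -> T} | M%:R * tau < \sum_t Z (w t)]|%:R <=
  (#|T| ^ M)%:R * expR (- (M%:R * (tau ^+ 2 / (8 * B ^+ 2)))).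
Proof.
move=> Z0 ZB B0 /andP[t0 tB].
pose l := tau / (4 * B ^+ 2).
have l0 : 0 <= l by rewrite divr_ge0 // mulr_ge0 // sqr_ge0.
have lB : l * B <= 2^-1.
  rewrite /l mulrAC ler_pdivrMr ?mulr_gt0 ?exprn_gt0 //; nra.
apply: (@le_trans _ _ (\sum_(w : {ffun 'I_M -> T})
    \prod_t expR (l * Z (w t)) * expR (- (M%:R * (l * tau))))).
  rewrite -sum1dep_card natr_sum big_mkcond; apply: ler_sum => w _.
  rewrite -expR_sum -exp.expRD -mulr_sumr.
  case: ifP => [Hw|_]; last exact/ltW/exp.expR_gt0.
  apply: le_trans (exp.expR_ge1Dx _); rewrite ler_wpDr //.
  by rewrite mulrCA -mulrBr mulr_ge0 // subr_ge0 ltW.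
rewrite -mulr_suml -(bigA_distr_bigA (fun _ x => expR (l * Z x))) prodr_const card_ord.
have S : \sum_x expR (l * Z x) <= #|T|%:R * expR (2 * l ^+ 2 * B ^+ 2).
  apply: (@le_trans _ _ (\sum_x (1 + l * Z x + 2 * l ^+ 2 * B ^+ 2))).
    apply: ler_sum => x _; have /andP[z1 z2] := ZB x.
    apply: le_trans (expR_quadratic_bound _) _.
      apply/andP; split; last by apply: le_trans lB; rewrite ler_wpM2l.
      by rewrite lerNl; apply: le_trans lB; rewrite -mulrN ler_wpM2l // lerNl.
    rewrite lerD2l -mulrA ler_wpM2l // exprMn ler_wpM2l ?sqr_ge0 //.
    nra.
  rewrite !big_split /= -mulr_sumr Z0 mulr0 addr0 !sumr_const.
  by rewrite -[X in _ + X]mulr_natl -[X in X + _]mulr1 -mulrDr ler_wpM2l // exp.expR_ge1Dx.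
apply: (@le_trans _ _ ((#|T|%:R * expR (2 * l ^+ 2 * B ^+ 2)) ^+ M * expR (- (M%:R * (l * tau))))).
  apply: ler_wpM2r; first exact/ltW/exp.expR_gt0.
  apply: lerXn2r => //; rewrite nnegrE.
    by apply: sumr_ge0 => x _; exact/ltW/exp.expR_gt0.
  by rewrite mulr_ge0 //; exact/ltW/exp.expR_gt0.
rewrite exprMn natrX -[leLHS]mulrA ler_wpM2l ?exprn_ge0 // -expR_nat -exp.expRD.
rewrite le_eqVlt; apply/orP; left; apply/eqP; congr expR; rewrite /l; field.
exact: lt0r_neq0.
Qed.

End Chernoff.

Section RandomCost.
Variables (R : realType) (M L : nat).
Hypothesis L_gt0 : (0 < L)%N.
Notation Omega := {ffun 'I_M -> {ffun 'I_4 -> 'I_L}}.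
Notation cube := {ffun 'I_4 * 'I_L -> R}.
Implicit Types (y : cube) (w : Omega).

Definition mean y (i : 'I_4) : R := (\sum_l y (i, l)) / L%:R.

Definition cost y w : R := \sum_t quad (fun i => y (i, w t i)).

Let L_neq0 : L%:R != 0 :> R.
Proof. by rewrite pnatr_eq0 -lt0n. Qed.

Lemma mean_itv y : (forall p, -1 <= y p <= 1) -> forall i, -1 <= mean y i <= 1.
Proof.
move=> Hy i; have L0 : 0 < L%:R :> R by rewrite ltr0n.
rewrite /mean ler_pdivlMr // ler_pdivrMr // mulN1r mul1r.
have -> : L%:R = \sum_(l < L) 1 :> R by rewrite sumr_const card_ord.
rewrite -sumrN; apply/andP; split; apply: ler_sum => l _;
  by case/andP: (Hy (i, l)).
Qed.

Definition monomial (b : seq bool) (z : 'I_4 -> R) : R :=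
  \prod_(i < 4) (if nth false b i then z i else 1).

Lemma quad_monomial (z : 'I_4 -> R) : quad z =
  5 / 4 * monomial [::] z
  - 1 / 4 * monomial [:: true; true] z - 1 / 4 * monomial [:: false; false; true; true] z
  - 1 / 4 * monomial [:: true; false; true] z - 1 / 4 * monomial [:: false; true; false; true] z
  - 1 / 4 * monomial [:: true; false; false; true] z - 1 / 4 * monomial [:: false; true; true] z
  + 1 / 4 * monomial [:: true; true; true; true] z.
Proof. by rewrite /monomial !big_ord4 /quad /=; field. Qed.

Lemma sum_monomial b y :
  \sum_(x : {ffun 'I_4 -> 'I_L}) monomial b (fun i => y (i, x i)) =
  (L ^ 4)%:R * monomial b (mean y).
Proof.
rewrite /monomial -(bigA_distr_bigA (fun (i : 'I_4) l => if nth false b i then y (i, l) else 1)).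
rewrite natrX -[X in L%:R ^+ X]card_ord -prodr_const -big_split /=.
apply: eq_bigr => i _; case: ifP => _; first by rewrite /mean mulrC divfK.
by rewrite sumr_const card_ord mulr1.
Qed.

Lemma sum_quad y :
  \sum_(x : {ffun 'I_4 -> 'I_L}) quad (fun i => y (i, x i)) = (L ^ 4)%:R * quad (mean y).
Proof.
under eq_bigr => x _ do rewrite quad_monomial.
rewrite !big_split /= !sumrN -!mulr_sumr !sum_monomial quad_monomial; ring.
Qed.

Definition vertex (b : {ffun 'I_4 * 'I_L -> bool}) : cube := [ffun p => (-1) ^+ b p].

Definition cheap (tau : R) w : bool :=
  [exists b, cost (vertex b) w < M%:R * (quad (mean (vertex b)) - tau)].

Lemma cost_ge tau w y : ~~ cheap tau w -> (forall p, -1 <= y p <= 1) ->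
  M%:R * (quad (mean y) - tau) <= cost y w.
Proof.
rewrite negb_exists => /forallP Hw Hy.
pose F z := cost z w - M%:R * quad (mean z).
have HF z p v : F (upd z p v) = (1 + v) / 2 * F (upd z p 1) + (1 - v) / 2 * F (upd z p (-1)).
  have C : cost (upd z p v) w =
      (1 + v) / 2 * cost (upd z p 1) w + (1 - v) / 2 * cost (upd z p (-1)) w.
    rewrite /cost !mulr_sumr -big_split /=; apply: eq_bigr => t _.
    apply: (quad_affine (i := p.1)) => [j jp|].
      have E : ((j, w t j) == p) = false.
        by apply: contra_neqF jp => /eqP E; rewrite -E.
      by rewrite !ffunE E.
    by rewrite !ffunE; case: eqP => _; field.
  have E : quad (mean (upd z p v)) =
      (1 + v) / 2 * quad (mean (upd z p 1)) + (1 - v) / 2 * quad (mean (upd z p (-1))).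
    apply: (quad_affine (i := p.1)) => [j jp|].
      have E u : mean (upd z p u) j = mean z j.
        congr (_ / _); apply: eq_bigr => l _; rewrite ffunE.
        by case: eqP => // E; rewrite -E eqxx in jp.
      by rewrite !E.
    have E u : mean (upd z p u) p.1 = (u + \sum_(l | l != p.2) z (p.1, l)) / L%:R.
      congr (_ / _); rewrite (bigD1 p.2) //= ffunE -surjective_pairing eqxx.
      congr (_ + _); apply: eq_bigr => l lp; rewrite ffunE.
      by case: eqP => // E; rewrite -E eqxx in lp.
    by rewrite !E; field.
  by rewrite /F C E; ring.
have [b Hb] := multiaffine_min HF Hy.
have := Hw b; rewrite -leNgt /vertex; move: Hb; rewrite /F; lra.
Qed.

Lemma card_cheap (tau : R) (D : nat) : 0 < tau <= 1 -> M = (D * L)%N ->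
  1440 <= D%:R * tau ^+ 2 ->
  #|[set w | cheap tau w]|%:R <= #|Omega|%:R / (1 + L%:R) :> R.
Proof.
move=> /andP[t0 t1] ML Dt.
pose Q (b : {ffun 'I_4 * 'I_L -> bool}) w :=
  M%:R * tau < \sum_t (quad (mean (vertex b)) - quad (fun i => vertex b (i, w t i))).
have H w : cheap tau w -> exists2 b, true & Q b w.
  move=> /existsP[b Hb]; exists b => //.
  by rewrite /Q sumrB sumr_const card_ord -[X in _ < X - _]mulr_natl; move: Hb; rewrite /cost; lra.
have := union_bound (J := xpredT) H; rewrite -(ler_nat R) natr_sum => /le_trans; apply.
have vi b p : -1 <= vertex b p <= 1.
  by rewrite ffunE; case: (b p); rewrite ?expr1 ?expr0; lra.
pose e := sequences.expR (- (M%:R * (tau ^+ 2 / (8 * 6 ^+ 2)))).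
apply: (@le_trans _ _ (\sum_(b : {ffun 'I_4 * 'I_L -> bool}) #|Omega|%:R * e)).
  apply: ler_sum => b _; rewrite card_ffun card_ord.
  pose Z (x : {ffun 'I_4 -> 'I_L}) := quad (mean (vertex b)) - quad (fun i => vertex b (i, x i)).
  apply: (@chernoff R _ M Z 6 tau) => //; last by apply/andP; split; lra.
    rewrite /Z sumrB sumr_const sum_quad card_ffun !card_ord.
    by rewrite -[X in X - _]mulr_natl subrr.
  move=> x; rewrite /Z.
  have /andP[? ?] := quad_abs_le (mean_itv (vi b)).
  have /andP[? ?] : -3 <= quad (fun i => vertex b (i, x i)) <= 3.
    by apply: quad_abs_le => i.
  by apply/andP; split; lra.
rewrite sumr_const (_ : #|_| = 2 ^ (4 * L))%N; last first.
  by rewrite card_ffun card_bool card_prod !card_ord.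
rewrite -[leLHS]mulr_natr -mulrA ler_wpM2l //.
have e5 : e <= sequences.expR (- L%:R) ^+ 5.
  rewrite -expR_nat /e exp.ler_expR ML natrM.
  have : 0 <= L%:R * (D%:R * tau ^+ 2 - 1440) by rewrite mulr_ge0 // subr_ge0.
  lra.
have E0 : 0 < sequences.expR (L%:R : R) by exact: exp.expR_gt0.
have E2 : 2 ^+ L <= sequences.expR (L%:R : R).
  rewrite -[X in sequences.expR X]mulr1 expR_nat; apply: lerXn2r; rewrite ?nnegrE //.
    exact/ltW/exp.expR_gt0.
  exact: exp.expR_ge1Dx.
apply: (@le_trans _ _ (sequences.expR (- L%:R) ^+ 5 * sequences.expR (L%:R : R) ^+ 4)).
  apply: ler_pM => //; first exact/ltW/exp.expR_gt0.
  rewrite natrX mulnC exprM; apply: lerXn2r; rewrite ?nnegrE ?exprn_ge0 //; exact: ltW.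
rewrite exp.expRN (_ : _ * _ = (sequences.expR (L%:R : R))^-1); last first.
  by field; exact: lt0r_neq0.
rewrite lef_pV2 ?posrE //; first exact: exp.expR_ge1Dx.
by rewrite ltr_wpDr // ler0n.
Qed.

End RandomCost.

(** * The sampling program *)

Section Machine.
Local Open Scope nat_scope.
Variable tape : nat -> bool.
Implicit Types (c : cmd) (k : seq cmd) (m : memory) (t d : nat).

Definition steps t d (s : config) : config := foldl step s [seq tape i | i <- iota t d].

Definition runs c t m d m' : Prop := forall k, steps t d (c :: k, m) = (k, m').

Lemma steps_add t d1 d2 s : steps t (d1 + d2) s = steps (t + d1) d2 (steps t d1 s).
Proof. by rewrite /steps iotaD map_cat foldl_cat. Qed.

Lemma stepsS t d s : steps t d.+1 s = steps t.+1 d (step s (tape t)).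
Proof. by []. Qed.

Lemma runs_Seq c1 c2 t m d1 m1 d2 m2 d :
  runs c1 t.+1 m d1 m1 -> runs c2 (t.+1 + d1) m1 d2 m2 -> d = (d1 + d2).+1 ->
  runs (Seq c1 c2) t m d m2.
Proof. by move=> H1 H2 -> k; rewrite stepsS steps_add /= H1 H2. Qed.

Lemma runs_While r c t d (s : nat -> memory) cnt D :
  (forall j, j < cnt -> s j r != 0) -> s cnt r = 0 ->
  (forall j, j < cnt -> runs c (t.+1 + j * d.+1) (s j) d (s j.+1)) ->
  D = (cnt * d.+1).+1 ->
  runs (While r c) t (s 0) D (s cnt).
Proof.
move=> Hn H0 Hc -> k.
suff H j : j <= cnt -> steps t (j * d.+1) (While r c :: k, s 0) = (While r c :: k, s j).
  by rewrite -addn1 steps_add H // stepsS /= H0.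
elim: j => [|j IH] jc; first by [].
rewrite mulSn addnC steps_add (IH (ltnW jc)) stepsS /=.
have := Hn j jc; case: eqP => // _ _.
by rewrite -addSn Hc.
Qed.

Definition ram (regs out : seq nat) : memory :=
  fun a => if a < 20 then nth 0 regs a else nth 0 out (a - 20).

Definition exec1 (bit : bool) c (st : seq nat * seq nat) : seq nat * seq nat :=
  let: (regs, out) := st in
  match c with
  | Const r x => (set_nth 0 regs r x, out)
  | Add r s t => (set_nth 0 regs r (nth 0 regs s + nth 0 regs t), out)
  | Defs.Sub r s t => (set_nth 0 regs r (nth 0 regs s - nth 0 regs t), out)
  | Flip r => (set_nth 0 regs r bit, out)
  | Store r s => (regs, rcons out (nth 0 regs s))
  | _ => st
  end.

Definition safe1 c (st : seq nat * seq nat) : Prop :=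
  match c with
  | Const r _ | Flip r => r < 20
  | Add r s t | Defs.Sub r s t => [&& r < 20, s < 20 & t < 20]
  | Store r s => [/\ r < 20, s < 20 & nth 0 st.1 r = 20 + size st.2]
  | _ => False
  end.

Fixpoint exec t (cs : seq cmd) st :=
  if cs is c :: cs then exec t.+2 cs (exec1 (tape t.+1) c st) else st.

Fixpoint safe t (cs : seq cmd) st : Prop :=
  if cs is c :: cs then safe1 c st /\ safe t.+2 cs (exec1 (tape t.+1) c st) else True.

Definition block (cs : seq cmd) : cmd := foldr Seq Skip cs.

Lemma ram_set_nth regs out r x : r < 20 ->
  update (ram regs out) r x = ram (set_nth 0 regs r x) out.
Proof.
move=> r20; apply: functional_extensionality_dep => a; rewrite /update /ram nth_set_nth /=.
by case: eqP => [->|_]; rewrite ?r20.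
Qed.

Lemma ram_rcons regs out x :
  update (ram regs out) (20 + size out) x = ram regs (rcons out x).
Proof.
apply: functional_extensionality_dep => a; rewrite /update /ram nth_rcons.
case: eqP => [->|/eqP H]; first by rewrite addKn ltnn eqxx ltnNge leq_addr.
case: ltnP => // a20; case: ltngtP => // [H1|H1].
  by rewrite nth_default // ltnW.
by case/eqP: H; rewrite -H1 subnKC.
Qed.

Lemma step_exec1 bit c k st : safe1 c st ->
  step (c :: k, ram st.1 st.2) bit =
  (k, ram (exec1 bit c st).1 (exec1 bit c st).2).
Proof.
case: st => regs out; case: c => //=.
- by move=> r x r20; rewrite ram_set_nth.
- by move=> r s t /and3P[r20 s20 t20]; rewrite ram_set_nth // /ram s20 t20.
- by move=> r s t /and3P[r20 s20 t20]; rewrite ram_set_nth // /ram s20 t20.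
- by move=> r s [r20 s20 E]; rewrite -ram_rcons /= /ram r20 s20 E.
- by move=> r r20; rewrite ram_set_nth.
Qed.

Lemma runs_block cs t st d : safe t cs st -> d = (size cs).*2.+1 ->
  runs (block cs) t (ram st.1 st.2) d (ram (exec t cs st).1 (exec t cs st).2).
Proof.
move=> Hs -> k; elim: cs t st Hs => [|c cs IH] t st //= [H1 H2].
by rewrite doubleS 2!stepsS [step (Seq _ _ :: _, _) _]/= step_exec1 // IH.
Qed.

End Machine.

Section Program.
Local Open Scope nat_scope.

Variables (C D h : nat).
(* Registers: 0 input, then number of edges; 1 base address of the edge list;
   2 the constant 1; 3 L; 4 b; 5 M; 6 K; 7 first auxiliary vertex; 8 current
   auxiliary vertex; 9 first literal of the block; 10 literal, then its copies;
   11-14 loop counters; 15 output pointer; 16 scratch; 17, 18 filler pair; 19 4L. *)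
Definition prog_init : cmd := block
  [:: Const 1 20; Const 2 1; Const 3 1; Const 19 (C + C); Add 16 0 2; Defs.Sub 16 16 19].
Definition prog_double : cmd := While 16 (block
  [:: Add 3 3 3; Add 4 4 2; Add 19 19 19; Add 16 0 2; Defs.Sub 16 16 19]).
Definition prog_scale : cmd := While 11 (block [:: Add 5 5 3; Defs.Sub 11 11 2]).
Definition prog_room : cmd := block
  [:: Add 19 3 3; Add 19 19 19; Defs.Sub 10 0 5; Defs.Sub 10 10 5; Defs.Sub 10 10 2;
      Defs.Sub 10 10 2; Add 16 10 2; Defs.Sub 16 16 19].
Definition prog_divide : cmd := While 16 (block
  [:: Defs.Sub 10 10 19; Add 6 6 2; Add 7 7 19; Add 16 10 2; Defs.Sub 16 16 19]).
Definition prog_setup : cmd := block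
  [:: Const 10 0; Add 8 7 16; Add 17 7 5; Add 17 17 5; Add 18 17 2; Const 15 20; Const 0 0;
      Add 11 5 16].

Definition prog_edge : cmd := While 14 (block
  [:: Store 15 8; Add 15 15 2; Store 15 10; Add 15 15 2; Add 0 0 2; Defs.Sub 14 14 2]).
Definition prog_copies : cmd := While 13
  (Seq (block [:: Const 14 h])
  (Seq prog_edge
       (block [:: Store 15 17; Add 15 15 2; Store 15 18; Add 15 15 2; Add 0 0 2;
                  Add 10 10 19; Defs.Sub 13 13 2]))).
Definition prog_flips : cmd := While 13
  (block [:: Flip 16; Add 10 10 10; Add 10 10 16; Defs.Sub 13 13 2]).
Definition prog_literals : cmd := While 12
  (Seq (block [:: Add 13 4 16])
  (Seq prog_flips
  (Seq (block [:: Add 10 10 9; Const 16 0; Add 13 6 16])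
  (Seq prog_copies
       (block [:: Add 9 9 3; Const 10 0; Defs.Sub 12 12 2]))))).
Definition prog_constraints : cmd := While 11
  (Seq (block [:: Const 12 4])
  (Seq prog_literals
       (block [:: Const 9 0; Add 8 8 2; Add 8 8 2; Defs.Sub 11 11 2]))).

Definition program : cmd :=
  Seq prog_init (Seq prog_double (Seq (block [:: Const 11 D]) (Seq prog_scale
  (Seq prog_room (Seq prog_divide (Seq prog_setup prog_constraints)))))).

Lemma runs_block_eq tape cs t regs out regs' out' d :
  safe tape t cs (regs, out) -> exec tape t cs (regs, out) = (regs', out') ->
  d = (size cs).*2.+1 -> runs tape (block cs) t (ram regs out) d (ram regs' out').
Proof. by move=> Hs He Hd; have := runs_block Hs Hd; rewrite He. Qed.

Lemma pair_cons_eq (x y : nat) s s' (o o' : seq nat) :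
  x = y -> (s, o) = (s', o') -> (x :: s, o) = (y :: s', o').
Proof. by move=> -> [-> ->]. Qed.

Definition flat (es : seq (nat * nat)) : seq nat := flatten [seq [:: e.1; e.2] | e <- es].

Lemma size_flat es : size (flat es) = (size es).*2.
Proof. by elim: es => //= e es IH; rewrite /flat /= in IH *; rewrite IH. Qed.

Lemma flat_rcons es e : flat (rcons es e) = rcons (rcons (flat es) e.1) e.2.
Proof. by rewrite /flat map_rcons flatten_rcons -!cats1 -catA. Qed.

Lemma nseq_rcons (T : Type) n (x : T) : nseq n.+1 x = rcons (nseq n x) x.
Proof. by rewrite -addn1 nseqD cats1. Qed.

Lemma flatten_iotaS (T : Type) (F : nat -> seq T) k :
  flatten [seq F j | j <- iota 0 k.+1] = flatten [seq F j | j <- iota 0 k] ++ F k.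
Proof. by rewrite -addn1 iotaD map_cat flatten_cat /= cats0. Qed.

Lemma nth_flat es i : i < size es ->
  (nth 0 (flat es) i.*2, nth 0 (flat es) i.*2.+1) = nth (0, 0) es i.
Proof.
elim: es i => // -[x y] es IH [|i] //= H; exact: IH.
Qed.

Section Emission.
Variables (tape : nat -> bool) (L b M K V0 f : nat).

Definition state es wv base lt ct ci ck ch sc : memory :=
  ram [:: size es; 20; 1; L; b; M; K; V0; wv; base; lt; ct; ci; ck; ch;
          20 + (size es).*2; sc; f; f.+1; 4 * L] (flat es).

Ltac run_block := apply: runs_block_eq;
  [ rewrite /= ?size_rcons ?size_flat; repeat split; lia
  | rewrite /=; repeat (apply: pair_cons_eq; [rewrite ?size_rcons ?size_cat /=; lia|]);
    rewrite ?flat_rcons //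
  | by [] ].

Lemma runs_edge es wv base lt ct ci ck t :
  runs tape prog_edge t (state es wv base lt ct ci ck h 0) (h * 14).+1
    (state (es ++ nseq h (wv, lt)) wv base lt ct ci ck 0 0).
Proof.
pose s j := state (es ++ nseq j (wv, lt)) wv base lt ct ci ck (h - j) 0.
have -> : state es wv base lt ct ci ck h 0 = s 0 by rewrite /s cats0 subn0.
have -> : state (es ++ nseq h (wv, lt)) wv base lt ct ci ck 0 0 = s h by rewrite /s subnn.
apply: (@runs_While _ _ _ _ 13) => //.
- by move=> j jh; rewrite /s /state /ram /= -lt0n subn_gt0.
- by rewrite /s /state /ram /= subnn.
move=> j jh; rewrite /s /state nseq_rcons -rcons_cat.
run_block.
Qed.

Fixpoint bitval (x : nat -> bool) j :=
  if j is j'.+1 then bitval x j' + bitval x j' + x j' else 0.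

Lemma eq_bitval x y j : x =1 y -> bitval x j = bitval y j.
Proof. by move=> E; elim: j => //= j ->; rewrite E. Qed.

Definition copies wv v k : seq (nat * nat) :=
  flatten [seq nseq h (wv, v + j * (4 * L)) ++ [:: (f, f.+1)] | j <- iota 0 k].

Lemma copiesS wv v k : copies wv v k.+1 =
  rcons (copies wv v k ++ nseq h (wv, v + k * (4 * L))) (f, f.+1).
Proof.
by rewrite /copies flatten_iotaS catA cats1.
Qed.

Lemma runs_copies es wv base lt ct ci t :
  runs tape prog_copies t (state es wv base lt ct ci K 0 0) (K * (h * 14 + 22)).+1
    (state (es ++ copies wv lt K) wv base (lt + K * (4 * L)) ct ci 0 0 0).
Proof.
pose s j := state (es ++ copies wv lt j) wv base (lt + j * (4 * L)) ct ci (K - j) 0 0.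
have -> : state es wv base lt ct ci K 0 0 = s 0.
  by rewrite /s cats0 subn0 mul0n addn0.
have -> : state (es ++ copies wv lt K) wv base (lt + K * (4 * L)) ct ci 0 0 0 = s K.
  by rewrite /s subnn.
apply: (@runs_While _ _ _ _ (h * 14 + 21)) => //.
- by move=> j jK; rewrite /s /state /ram /= -lt0n subn_gt0.
- by rewrite /s /state /ram /= subnn.
- move=> j jK; pose v := lt + j * (4 * L).
  have H0 := runs_edge (es ++ copies wv lt j) wv base v ct ci (K - j).
  apply: (@runs_Seq _ _ _ _ _ 3
      (state (es ++ copies wv lt j) wv base v ct ci (K - j) h 0)).
  + by rewrite /s /state; run_block.
  + apply: (@runs_Seq _ _ _ _ _ _ _ 15 _ _ (H0 _)); last by [].
    by rewrite /s /state copiesS -rcons_cat catA; run_block.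
  + by lia.
- by rewrite addnS.
Qed.

Lemma runs_flips es wv base ct ci t : exists sc,
  runs tape prog_flips t (state es wv base 0 ct ci b 0 0) (b * 10).+1
    (state es wv base (bitval (fun j => tape (t.+2 + j * 10)) b) ct ci 0 0 sc).
Proof.
pose x j := tape (t.+2 + j * 10).
pose sc j : nat := if j is j'.+1 then x j' else 0.
pose s j := state es wv base (bitval x j) ct ci (b - j) 0 (sc j).
exists (sc b).
have -> : state es wv base 0 ct ci b 0 0 = s 0 by rewrite /s subn0.
have -> : state es wv base (bitval x b) ct ci 0 0 (sc b) = s b by rewrite /s subnn.
apply: (@runs_While _ _ _ _ 9) => //.
- by move=> j jK; rewrite /s /state /ram /= -lt0n subn_gt0.
- by rewrite /s /state /ram /= subnn.
move=> j jb; rewrite /s /state.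
have -> : sc j.+1 = tape (t.+1 + j * 10).+1 by [].
have -> : bitval x j.+1 = bitval x j + bitval x j + tape (t.+1 + j * 10).+1 by [].
run_block.
Qed.

Definition literal_time := K * (h * 14 + 22) + b * 10 + 23.
Definition constraint_time := 4 * literal_time.+1 + 15.

Definition literals_edges wv (r : nat -> nat) i :=
  flatten [seq copies wv (j * L + r j) K | j <- iota 0 i].

Lemma literals_edgesS wv r i :
  literals_edges wv r i.+1 = literals_edges wv r i ++ copies wv (i * L + r i) K.
Proof.
exact: flatten_iotaS.
Qed.

Lemma runs_literals es wv ct t :
  runs tape prog_literals t (state es wv 0 0 ct 4 0 0 0) (4 * literal_time.+1).+1
    (state (es ++ literals_edges wv
       (fun i => bitval (fun j => tape (t + 8 + i * literal_time.+1 + j * 10)) b) 4)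
       wv (4 * L) 0 ct 0 0 0 0).
Proof.
set r := (X in literals_edges wv X).
pose s j := state (es ++ literals_edges wv r j) wv (j * L) 0 ct (4 - j) 0 0 0.
have -> : state es wv 0 0 ct 4 0 0 0 = s 0 by rewrite /s cats0.
have -> : state (es ++ literals_edges wv r 4) wv (4 * L) 0 ct 0 0 0 0 = s 4 by [].
apply: (@runs_While _ _ _ _ literal_time) => //.
  by case=> [|[|[|[|]]]].
move=> i i4; set u := t.+1 + i * literal_time.+1.
rewrite /s literals_edgesS catA.
set es' := es ++ literals_edges wv r i.
have [sc F] := runs_flips es' wv (i * L) ct (4 - i) (u + 5).
have E : bitval (fun j => tape ((u + 5).+2 + j * 10)) b = r i.
  by apply: eq_bitval => j; congr tape; rewrite /u; lia.
rewrite E in F.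
apply: (@runs_Seq _ _ _ _ _ 3 (state es' wv (i * L) 0 ct (4 - i) b 0 0)).
- by rewrite /state; run_block.
- apply: (@runs_Seq _ _ _ _ _ (b * 10).+1); last by [].
    by rewrite (_ : (u.+1 + 3).+1 = u + 5); [exact: F | lia].
  apply: (@runs_Seq _ _ _ _ _ 7 (state es' wv (i * L) (i * L + r i) ct (4 - i) K 0 0)).
  + by rewrite /state; run_block.
  + apply: (@runs_Seq _ _ _ _ _ _ _ 7 _ _ (runs_copies _ _ _ _ _ _ _)); last by [].
    by rewrite /state; run_block.
  + by [].
- by rewrite /literal_time; lia.
Qed.

Definition constraints_edges (r : nat -> nat -> nat) t :=
  flatten [seq literals_edges (V0 + u * 2) (r u) 4 | u <- iota 0 t].

Lemma constraints_edgesS r t :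
  constraints_edges r t.+1 = constraints_edges r t ++ literals_edges (V0 + t * 2) (r t) 4.
Proof.
exact: flatten_iotaS.
Qed.

Definition flip_time T0 t i j :=
  T0 + 14 + t * constraint_time.+1 + i * literal_time.+1 + j * 10.

Definition sampled T0 t i := bitval (fun j => tape (flip_time T0 t i j)) b.

Lemma eq_literals_edges wv r r' i : r =1 r' ->
  literals_edges wv r i = literals_edges wv r' i.
Proof.
by move=> E; congr flatten; apply: eq_map => j; rewrite E.
Qed.

Lemma runs_constraints T0 :
  runs tape prog_constraints T0 (state [::] V0 0 0 M 0 0 0 0) (M * constraint_time.+1).+1
    (state (constraints_edges (sampled T0) M) (V0 + M * 2) 0 0 0 0 0 0 0).
Proof.
pose s t := state (constraints_edges (sampled T0) t) (V0 + t * 2) 0 0 (M - t) 0 0 0 0.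
have -> : state [::] V0 0 0 M 0 0 0 0 = s 0.
  by rewrite /s subn0 mul0n addn0.
have -> : state (constraints_edges (sampled T0) M) (V0 + M * 2) 0 0 0 0 0 0 0 = s M.
  by rewrite /s subnn.
apply: (@runs_While _ _ _ _ constraint_time) => //.
- by move=> j jK; rewrite /s /state /ram /= -lt0n subn_gt0.
- by rewrite /s /state /ram /= subnn.
move=> t tM; rewrite /s constraints_edgesS; set u := T0.+1 + _.
set es := constraints_edges _ t.
have H := runs_literals es (V0 + t * 2) (M - t) (u + 5).
rewrite (@eq_literals_edges _ _ (sampled T0 t)) in H; last first.
  move=> i; apply: eq_bitval => j; congr tape; rewrite /flip_time /u; lia.
apply: (@runs_Seq _ _ _ _ _ 3 (state es (V0 + t * 2) 0 0 (M - t) 4 0 0 0)).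
- by rewrite /state; run_block.
- apply: (@runs_Seq _ _ _ _ _ _ _ 9); last by [].
    by rewrite (_ : (u.+1 + 3).+1 = u + 5); [exact: H | lia].
  by rewrite /state; run_block.
- by rewrite /constraint_time; lia.
Qed.
End Emission.

Section Run.
Hypothesis C_gt0 : 0 < C.
Variable n : nat.

Definition log_size := trunc_log 2 (n %/ C).
Definition block_size := 2 ^ log_size.
Definition constraint_count := D * block_size.
Definition copy_count := (n - 2 * constraint_count - 2) %/ (4 * block_size).
Definition first_aux := copy_count * (4 * block_size).
Definition filler := first_aux + constraint_count * 2.
Definition start_time := 60 + 12 * log_size + 6 * D + 12 * copy_count.
Definition run_time :=
  (start_time + constraint_count * (constraint_time log_size copy_count).+1).+1.

Local Notation b := log_size.
Local Notation L := block_size.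
Local Notation M := constraint_count.
Local Notation K := copy_count.
Local Notation V0 := first_aux.

Ltac run_block0 := apply: runs_block_eq;
  [ rewrite /=; repeat split; lia
  | rewrite /=; repeat (apply: pair_cons_eq; [lia|]); by [] | by [] ].

Lemma double_guard j : j < b -> 2 ^ j.+1 * C <= n.
Proof.
move=> jb; have q0 : 0 < n %/ C.
  by rewrite lt0n; apply: contraTneq jb => q0; rewrite /b q0 trunc_log0.
rewrite -leq_divRL //; apply: leq_trans (trunc_logP (isT : 1 < 2) q0).
by rewrite leq_exp2l.
Qed.

Lemma double_exit : n < 2 ^ b.+1 * C.
Proof. by rewrite -ltn_divLR //; apply: trunc_log_ltn. Qed.

Variable tape : nat -> bool.

Definition emitted : seq (nat * nat) :=
  constraints_edges L K V0 filler (sampled tape b K start_time) M.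

Lemma runs_program : runs tape program 0 (ram (n :: nseq 19 0) [::]) run_time
  (state L b M K V0 filler emitted (V0 + M * 2) 0 0 0 0 0 0 0).
Proof.
pose s1 j := ram [:: n; 20; 1; 2 ^ j; j; 0; 0; 0; 0; 0; 0; 0; 0; 0; 0; 0;
                     n + 1 - 2 ^ j * (C + C); 0; 0; 2 ^ j * (C + C)] [::].
have W1 t : runs tape prog_double t (s1 0) (b * 12).+1 (s1 b).
  apply: (@runs_While _ _ _ _ 11) => //.
  - move=> j jb; rewrite /s1 /ram /=; have := double_guard jb.
    by rewrite expnS; lia.
  - by rewrite /s1 /ram /=; have := double_exit; rewrite expnS; lia.
  - by move=> j jb; rewrite /s1 expnS; run_block0.
pose s2 j := ram [:: n; 20; 1; L; b; j * L; 0; 0; 0; 0; 0; D - j; 0; 0; 0; 0;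
                     n + 1 - L * (C + C); 0; 0; L * (C + C)] [::].
have W2 t : runs tape prog_scale t (s2 0) (D * 6).+1 (s2 D).
  apply: (@runs_While _ _ _ _ 5) => //.
  - by move=> j jD; rewrite /s2 /ram /= -lt0n subn_gt0.
  - by rewrite /s2 /ram /= subnn.
  - by move=> j jD; rewrite /s2; run_block0.
pose r := n - 2 * M - 2.
pose s3 j := ram [:: n; 20; 1; L; b; M; j; j * (4 * L); 0; 0; r - j * (4 * L); 0; 0; 0; 0; 0;
                     r - j * (4 * L) + 1 - 4 * L; 0; 0; 4 * L] [::].
have L4 : 0 < 4 * L by rewrite muln_gt0 expn_gt0.
have W3 t : runs tape prog_divide t (s3 0) (K * 12).+1 (s3 K).
  apply: (@runs_While _ _ _ _ 11) => //.
  - move=> j jK; rewrite /s3 /ram /=.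
    have : j.+1 * (4 * L) <= r by rewrite -leq_divRL.
    by rewrite mulSn; lia.
  - rewrite /s3 /ram /=.
    have : r < K.+1 * (4 * L) by rewrite -ltn_divLR.
    by rewrite mulSn; lia.
  - by move=> j jK; rewrite /s3 mulSn; run_block0.
apply: (@runs_Seq _ _ _ _ _ 13 (s1 0)).
- by rewrite /s1 expn0; run_block0.
- apply: (@runs_Seq _ _ _ _ _ _ _ _ _ _ (W1 _)); last by [].
  apply: (@runs_Seq _ _ _ _ _ 3 (s2 0)).
  + by rewrite /s1 /s2 subn0; run_block0.
  + apply: (@runs_Seq _ _ _ _ _ _ _ _ _ _ (W2 _)); last by [].
    apply: (@runs_Seq _ _ _ _ _ 17 (s3 0)).
    * by rewrite /s2 /s3 subnn -/M; run_block0.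
    * apply: (@runs_Seq _ _ _ _ _ _ _ _ _ _ (W3 _)); last by [].
      apply: (@runs_Seq _ _ _ _ _ 17 (state L b M K V0 filler [::] V0 0 0 M 0 0 0 0)).
      - have E0 : r - K * (4 * L) + 1 - 4 * L = 0.
          have : r < K.+1 * (4 * L) by rewrite -ltn_divLR.
          by rewrite mulSn; lia.
        rewrite /s3 /state E0 /filler -/V0; run_block0.
      - match goal with |- runs _ _ ?x _ _ _ =>
          have -> : x = start_time by rewrite /start_time; lia end.
        exact: runs_constraints.
      - by [].
    * by [].
  + by [].
- by rewrite /run_time /start_time; lia.
Qed.

Lemma output_state es wv base lt ct ci ck ch sc :
  output (state L b M K V0 filler es wv base lt ct ci ck ch sc) = es.
Proof.
rewrite /output /= /state /ram /=.
apply: (@eq_from_nth _ (0, 0)); first by rewrite size_map size_iota.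
move=> i; rewrite size_map size_iota => ies.
rewrite (nth_map 0) ?size_iota // nth_iota // add0n.
rewrite -addnS !addKn; exact: nth_flat.
Qed.

End Run.

Lemma run_program n (C_gt0 : 0 < C) (w : (run_time n).-tuple bool) :
  (run program n w).1 = [::] /\ output (run program n w).2 = emitted n (nth false w).
Proof.
have Ew : run program n w = steps (nth false w) 0 (run_time n) ([:: program], ram (n :: nseq 19 0) [::]).
  rewrite /run /steps map_nth_iota0 ?size_tuple // -[X in take X _](size_tuple w) take_size.
  congr (foldl _ (_, _) _); apply: functional_extensionality_dep => -[|a] //=.
  rewrite /ram; case: ltnP => //; last by rewrite nth_nil.
  by case: a => [|[|[|[|[|[|[|[|[|[|[|[|[|[|[|[|[|[|[|a]]]]]]]]]]]]]]]]]]].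
by rewrite Ew runs_program // output_state.
Qed.

End Program.

(** * Distribution of the sampled instance *)

Section Coins.
Local Open Scope nat_scope.

Lemma bitval_lt x b : bitval x b < 2 ^ b.
Proof.
elim: b => // b IH; rewrite /= expnS mul2n -addnn.
by case: (x b); lia.
Qed.

Lemma bitval_inj x y b : bitval x b = bitval y b -> forall j, j < b -> x j = y j.
Proof.
elim: b => // b IH /= E.
have xy : x b = y b by move: E; case: (x b); case: (y b); lia.
move=> j; rewrite ltnS leq_eqVlt => /orP[/eqP->//|]; apply: IH.
by move: E; rewrite xy; lia.
Qed.

Lemma radix_inj q d d' e e' : e < q -> e' < q -> d * q + e = d' * q + e' -> d = d' /\ e = e'.
Proof.
move=> eq e'q E; have := congr1 (modn^~ q) E; rewrite /= !modnMDl !modn_small // => ee.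
by split=> //; move: E; rewrite ee => /addIn/eqP; rewrite eqn_pmul2r => [/eqP|]; lia.
Qed.

Variables (C D h n : nat).
Notation b := (log_size C n).
Notation L := (block_size C n).
Notation M := (constraint_count C D n).
Notation K := (copy_count C D n).
Notation T := (run_time C D h n).
Notation Omega := {ffun 'I_M -> {ffun 'I_4 -> 'I_L}}.

Lemma sample_subproof (w : T.-tuple bool) (t : 'I_M) (i : 'I_4) :
  sampled h (nth false w) b K (start_time C D n) t i < L.
Proof. exact: bitval_lt. Qed.

Definition sample (w : T.-tuple bool) : Omega :=
  [ffun t => [ffun i => Ordinal (sample_subproof w t i)]].

Notation ftime := (flip_time h b K (start_time C D n)).

Lemma flip_time_lt t i j : t < M -> i < 4 -> j < b -> ftime t i j < T.
Proof.
move=> tM i4 jb; rewrite /flip_time /run_time.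
set c := constraint_time _ _ _; set l := literal_time _ _ _.
have : t.+1 * c.+1 <= M * c.+1 by rewrite leq_mul2r tM orbT.
have : i.+1 * l.+1 <= 4 * l.+1 by rewrite leq_mul2r i4 orbT.
have : b * 10 + 23 <= l by rewrite /l /literal_time; lia.
have : c = 4 * l.+1 + 15 by [].
rewrite !mulSn; lia.
Qed.

Definition flip_index (p : 'I_M * 'I_4 * 'I_b) : 'I_T :=
  Ordinal (flip_time_lt (ltn_ord p.1.1) (ltn_ord p.1.2) (ltn_ord p.2)).

Lemma flip_index_inj : injective flip_index.
Proof.
move=> [[t i] j] [[t' i'] j'] /(congr1 val) /=; rewrite /flip_time.
set l := literal_time _ _ _; set c := constraint_time _ _ _ => E.
have lb (x : 'I_b) : x * 10 < l.+1 by have := ltn_ord x; rewrite /l /literal_time; lia.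
have cb (x : 'I_4) (y : 'I_b) : x * l.+1 + y * 10 < c.+1.
  have := lb y; have : x.+1 * l.+1 <= 4 * l.+1 by rewrite leq_mul2r ltn_ord orbT.
  by rewrite /c /constraint_time -/l mulSn; lia.
have [tt E2] : nat_of_ord t = t' /\ i * l.+1 + j * 10 = i' * l.+1 + j' * 10.
  by apply: (radix_inj (cb i j) (cb i' j')); lia.
have [ii jj] := radix_inj (lb j) (lb j') E2.
by congr (_, _, _); apply: val_inj => //=; lia.
Qed.

Lemma card_sample_fiber (o : Omega) :
  #|[set w : T.-tuple bool | sample w == o]| <= 2 ^ (T - 4 * M * b).
Proof.
pose J := [set flip_index p | p : 'I_M * 'I_4 * 'I_b].
pose enc (w : T.-tuple bool) : {ffun 'I_T -> bool} :=
  [ffun k => if k \in J then false else tnth w k].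
have enc_inj : {in [set w : T.-tuple bool | sample w == o] &, injective enc}.
  move=> w w'; rewrite !inE => /eqP ow /eqP ow' E.
  apply: eq_from_tnth => k; have := congr1 (fun f : {ffun _} => f k) E.
  rewrite !ffunE; case: ifP => // /imsetP[[[t i] j] _ ->] _.
  have := congr1 (fun f : Omega => val (f t i)) (etrans ow (esym ow')).
  rewrite !ffunE /= => /bitval_inj/(_ j (ltn_ord j)).
  by rewrite !(tnth_nth false).
pose F (k : 'I_T) : {pred bool} := if k \in J then pred1 false else predT.
rewrite -(card_in_imset enc_inj); apply: (@leq_trans #|family F|).
  apply: subset_leq_card; apply/subsetP => _ /imsetP[w _ ->].
  apply/familyP => k; rewrite ffunE /F; case: ifP => // _; exact: eqxx.
rewrite card_family foldrE big_map big_enum /= (bigID (fun k => k \in J)) /=.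
rewrite big1 => [|k kJ]; last by rewrite /F kJ card1.
rewrite (eq_bigr (fun=> 2)) => [|k /negPf kJ]; last by rewrite /F kJ card_bool.
rewrite mul1n prod_nat_const leq_exp2l //.
have cJ : #|J| = 4 * M * b.
  by rewrite /J card_imset ?card_prod ?card_ord ?(mulnC M) //; exact: flip_index_inj.
have E := cardC (mem J); rewrite card_ord cJ in E.
have {}E : T - 4 * M * b = #|predC (mem J)|.
  by apply: (canLR (addKn (4 * M * b))); rewrite E.
by rewrite E; apply/subset_leq_card/subsetP.
Qed.

Lemma card_sample (P : pred Omega) :
  #|[set w : T.-tuple bool | P (sample w)]| * #|Omega| <= #|[set o | P o]| * 2 ^ T.
Proof.
have H w : P (sample w) -> exists2 o, P o & sample w == o by move=> Pw; exists (sample w).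
have -> : 2 ^ T = 2 ^ (T - 4 * M * b) * #|Omega|.
  have JT : 4 * M * b <= T.
    rewrite -[T]card_ord; apply: leq_trans (leq_card _ flip_index_inj).
    by rewrite !card_prod !card_ord (mulnC M).
  by rewrite card_Omega /L -expnM mulnC -expnD mulnC addnC; congr (2 ^ _); nia.
rewrite mulnA leq_mul2r; apply/orP; right.
apply: leq_trans (union_bound H) _.
apply: (@leq_trans (\sum_(o | P o) 2 ^ (T - 4 * M * b))).
  by apply: leq_sum => o _; exact: card_sample_fiber.
by rewrite sum_nat_const -sum1dep_card sum1_card.
Qed.

End Coins.

Lemma coin_prob_ge (R : realType) (C D h n : nat)
    (bad1 bad2 : pred {ffun 'I_(constraint_count C D n) -> {ffun 'I_4 -> 'I_(block_size C n)}})
    (A : (run_time C D h n).-tuple bool -> Prop) (p1 p2 : R) :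
  (forall w, ~~ bad1 (sample w) -> ~~ bad2 (sample w) -> A w) ->
  (0 < block_size C n)%N ->
  #|[set o | bad1 o]|%:R <= #|{: {ffun 'I_(constraint_count C D n) -> {ffun 'I_4 -> 'I_(block_size C n)}}}|%:R * p1 ->
  #|[set o | bad2 o]|%:R <= #|{: {ffun 'I_(constraint_count C D n) -> {ffun 'I_4 -> 'I_(block_size C n)}}}|%:R * p2 ->
  1 - (p1 + p2) <= coin_prob R A.
Proof.
move=> HA L0.
set N := #|{: {ffun 'I_(constraint_count C D n) -> {ffun 'I_4 -> 'I_(block_size C n)}}}|.
move=> H1 H2; set T := run_time C D h n.
have N0 : 0 < N%:R :> R by rewrite ltr0n /N card_Omega expn_gt0 L0.
have T0 : 0 < (2 ^ T)%:R :> R by rewrite ltr0n expn_gt0.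
have S (bad : pred _) p : #|[set o | bad o]|%:R <= N%:R * p ->
    #|[set w : T.-tuple bool | bad (sample w)]|%:R <= p * (2 ^ T)%:R :> R.
  move=> H; rewrite -(ler_pM2r N0) -natrM.
  have := card_sample h bad; rewrite -(ler_nat R) => /le_trans; apply.
  by rewrite natrM [leRHS]mulrAC ler_wpM2r // mulrC.
rewrite /coin_prob ler_pdivlMr // mulrBl mul1r mulrDl lerBlDr.
have H : (2 ^ T <= #|[set w : T.-tuple bool | `[< A w >]]| +
   (#|[set w : T.-tuple bool | bad1 (sample w)]| + #|[set w : T.-tuple bool | bad2 (sample w)]|))%N.
  rewrite -[X in (X <= _)%N](_ : #|[set: T.-tuple bool]| = _); last first.
    by rewrite cardsT card_tuple card_bool.
  apply: (@leq_trans #|[set w : T.-tuple bool | `[< A w >]] :|: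
     ([set w | bad1 (sample w)] :|: [set w | bad2 (sample w)])|).
    apply: subset_leq_card; apply/subsetP => w _; rewrite !inE.
    case: (boolP (bad1 (sample w))) => [|b1]; first by rewrite orbT.
    case: (boolP (bad2 (sample w))) => [|b2]; first by rewrite !orbT.
    by rewrite !orbF; apply/asboolP; exact: HA.
  apply: leq_trans (leq_card_setU _ _).1 _; rewrite leq_add2l.
  exact: (leq_card_setU _ _).1.
move: H; rewrite -(ler_nat R) natrD => /le_trans; apply.
by rewrite lerD2l natrD lerD // S.
Qed.

Section Graph.
Local Open Scope nat_scope.

Definition proper_edge n (e : nat * nat) : bool := [&& e.1 < n, e.2 < n & e.1 != e.2].

Definition edge_of_nat n (e : nat * nat) : option ('I_n * 'I_n) :=
  if (insub e.1, insub e.2) is (Some a, Some b) then Some (a, b) else None.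

Lemma mkgraph_subproof n (s : seq (nat * nat)) :
  all (fun e : 'I_n * 'I_n => e.1 != e.2)
    [seq e <- pmap (@edge_of_nat n) s | e.1 != e.2].
Proof. exact: filter_all. Qed.

Definition mkgraph n (s : seq (nat * nat)) : multigraph n :=
  exist (fun l : seq ('I_n * 'I_n) => all (fun e => e.1 != e.2) l) _ (mkgraph_subproof n s).

Lemma edges_mkgraph n (s : seq (nat * nat)) : all (proper_edge n) s ->
  [seq (nat_of_ord e.1, nat_of_ord e.2) | e <- edges (mkgraph n s)] = s.
Proof.
rewrite /edges /=; elim: s => //= -[x y] s IH /andP[/and3P[/= xn yn xy] /IH IHs].
by rewrite /edge_of_nat !insubT /= -val_eqE /= xy /= IHs.
Qed.

Variables (L K V0 f h : nat).

Lemma constraints_edgesP (r : nat -> nat -> nat) M e :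
  e \in constraints_edges h L K V0 f r M ->
  exists t i k, [/\ t < M, i < 4, k < K &
    e = (V0 + t * 2, i * L + r t i + k * (4 * L)) \/ e = (f, f.+1)].
Proof.
case/flattenP => _ /mapP[t + ->]; rewrite mem_iota => /andP[_ tM].
case/flattenP => _ /mapP[i + ->]; rewrite mem_iota => /andP[_ i4].
case/flattenP => _ /mapP[k + ->]; rewrite mem_iota => /andP[_ kK].
rewrite mem_cat mem_seq1 => He; exists t, i, k; split=> //.
case/orP: He => [/nseqP[-> _]|/eqP->]; [by left|by right].
Qed.

Lemma sum_constraints_edges (R : nzRingType) (r : nat -> nat -> nat) M (F : nat * nat -> R) :
  (\sum_(e <- constraints_edges h L K V0 f r M) F e =
   \sum_(t < M) \sum_(i < 4) \sum_(k < K)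
     (h%:R * F (V0 + t * 2, i * L + r t i + k * (4 * L))%N + F (f, f.+1)))%R.
Proof.
have sum_iota m (H : nat -> R) : (\sum_(i <- iota 0 m) H i = \sum_(i < m) H i)%R.
  by rewrite -(big_mkord xpredT) /index_iota subn0.
rewrite big_flatten big_map sum_iota; apply: eq_bigr => t _.
rewrite big_flatten big_map sum_iota; apply: eq_bigr => i _.
rewrite big_flatten big_map sum_iota; apply: eq_bigr => k _.
rewrite big_cat big_seq1 /=; congr (_ + _)%R.
by elim: h => [|h' IH]; rewrite ?big_nil ?mul0r // big_cons IH -natr1 mulrDl mul1r addrC.
Qed.

End Graph.

Lemma constraints_edges_proper (n L K M h : nat) (r : nat -> nat -> nat) :
  (forall t i, (t < M)%N -> (i < 4)%N -> (r t i < L)%N) ->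
  ((0 < K)%N -> (K * (4 * L) + M * 2 + 2 <= n)%N) ->
  all (proper_edge n) (constraints_edges h L K (K * (4 * L)) (K * (4 * L) + M * 2) r M).
Proof.
move=> rL room; apply/allP => e /constraints_edgesP[t [i [k [tM i4 kK]]]].
have kV : (k.+1 * (4 * L) <= K * (4 * L))%N by rewrite leq_mul2r kK orbT.
have iL : (i.+1 * L <= 4 * L)%N by rewrite leq_mul2r i4 orbT.
have {}rL := rL t i tM i4; have {}room := room (leq_ltn_trans (leq0n k) kK).
rewrite mulSn in kV; rewrite mulSn in iL.
case=> ->; rewrite /proper_edge /=; apply/and3P.
split; lia.
split; lia.
Qed.

(** * One instance *)

Lemma sum_pairs (R : zmodType) (F : nat -> R) m :
  (forall j, F j.*2 + F j.*2.+1 = 0) -> \sum_(v < m.*2) F v = 0.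
Proof.
move=> HF; elim: m => [|m IH]; first by rewrite big_ord0.
by rewrite doubleS !big_ord_recr /= IH add0r HF.
Qed.

Lemma sum_ord_mul (R : zmodType) (F : nat -> R) a q :
  \sum_(v < a * q) F v = \sum_(k < a) \sum_(j < q) F (k * q + j)%N.
Proof.
elim: a => [|a IH]; first by rewrite mul0n !big_ord0.
by rewrite mulSnr big_split_ord /= big_ord_recr /= -IH.
Qed.

Section Instance.
Variables (R : realType) (n H L M K c : nat).
Hypotheses (H_gt0 : (0 < H)%N) (LH : L = H.*2) (K_gt0 : (0 < K)%N) (M_gt0 : (0 < M)%N)
  (c_gt0 : (0 < c)%N) (room : (K * (4 * L) + M * 2 + 2 <= n)%N) (n_even : ~~ odd n).
Notation Omega := {ffun 'I_M -> {ffun 'I_4 -> 'I_L}}.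
Variables (w : Omega) (r : nat -> nat -> nat).
Hypothesis rE : forall (t : 'I_M) (i : 'I_4), r t i = w t i.
Notation cube := {ffun 'I_4 * 'I_L -> bool}.
Notation h := (3 * c - 1)%N.
Notation V0 := (K * (4 * L))%N.
Notation f := (V0 + M * 2)%N.

Definition instance_edges := constraints_edges h L K V0 f r M.

Let L_gt0 : (0 < L)%N. Proof. by rewrite LH double_gt0. Qed.

Definition polarity (t : 'I_M) (i : 'I_4) : bool := odd (w t i).
Notation lit := (lit R (var w) polarity).
Notation aux := (half_sum R (var w) polarity).

Definition pair_var j : 'I_4 * 'I_L :=
  (inord ((j %% (4 * H)) %/ H), insubd (Ordinal L_gt0) ((j %% (4 * H)) %% H)%N).

Definition pair_value j (x : cube) : R :=
  if (j < K * (4 * H))%N then (-1) ^+ x (pair_var j)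
  else if insub (j - K * (4 * H))%N is Some t then aux t x else 1.

(* Vertices [2j] and [2j + 1] receive opposite values, so every bisection
   constraint holds identically. *)
Definition vertex_value v (x : cube) : R := (-1) ^+ odd v * pair_value v./2 x.

Lemma vertex_value_lit (t : 'I_M) (i : 'I_4) k x : (k < K)%N ->
  vertex_value (i * L + r t i + k * (4 * L)) x = lit t i x.
Proof.
move=> kK; rewrite rE.
have rL := ltn_ord (w t i); have i4 := ltn_ord i.
have [m mE] : exists m, m = nat_of_ord (w t i) by eexists.
rewrite -mE in rL *; set v := (_ + _)%N.
have ov : odd v = odd m.
  by rewrite /v LH !oddD !oddM !odd_double !andbF /= ?addbF ?addFb.
have rh : (m./2 < H)%N by rewrite ltn_half_double -LH.
have hv : v./2 = (k * (4 * H) + (i * H + m./2))%N.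
  rewrite /v LH -[in LHS](odd_double_half m).
  rewrite (_ : (_ + _ = odd m + (k * (4 * H) + (i * H + m./2)).*2)%N); last first.
    by rewrite -!muln2; nia.
  by rewrite half_bit_double.
have q4 : (i * H + m./2 < 4 * H)%N.
  have : (i.+1 * H <= 4 * H)%N by rewrite leq_mul2r i4 orbT.
  by rewrite mulSn; lia.
have v0 : (v./2 < K * (4 * H))%N.
  have : (k.+1 * (4 * H) <= K * (4 * H))%N by rewrite leq_mul2r kK orbT.
  by rewrite hv mulSn; lia.
rewrite /vertex_value /pair_value v0 ov /lit /polarity mE signr_addb mulrC; congr (_ * _).
congr (_ ^+ (nat_of_bool (x _))).
rewrite /pair_var hv modnMDl modn_small // divnMDl // (divn_small rh) addn0.
rewrite modnMDl (modn_small rh) /var; congr (_, _).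
  by apply: val_inj; rewrite /= inordK.
apply: val_inj; rewrite /= val_insubd -mE ifT //.
by apply: leq_trans rh _; rewrite LH -addnn leq_addr.
Qed.

Let V0_double : V0 = (K * (4 * H)).*2.
Proof. by rewrite LH -!muln2 !mulnA. Qed.

Lemma vertex_value_aux (t : 'I_M) x : vertex_value (V0 + t * 2) x = aux t x.
Proof.
rewrite /vertex_value V0_double muln2 -doubleD odd_double doubleK expr0 mul1r.
by rewrite /pair_value ltnNge leq_addr /= addKn valK.
Qed.

Lemma vertex_value_filler x : vertex_value f x = 1 /\ vertex_value f.+1 x = -1.
Proof.
rewrite /vertex_value V0_double muln2 -doubleD /= odd_double uphalf_double doubleK expr0 expr1.
by rewrite /pair_value ltnNge leq_addr /= addKn insubF ?ltnn // !mulr1.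
Qed.

Lemma sum_vertex_value x : \sum_(v < n) vertex_value v x = 0.
Proof.
rewrite -[n]odd_double_half (negPf n_even) add0n.
apply: (@sum_pairs _ (fun v => vertex_value v x)) => j.
rewrite /vertex_value /= odd_double doubleK uphalf_double expr0 expr1; ring.
Qed.

Lemma sum_instance_edges (F : nat * nat -> R) :
  \sum_(e <- instance_edges) F e = \sum_(t < M) \sum_(i < 4) \sum_(k < K)
     (h%:R * F (V0 + t * 2, i * L + r t i + k * (4 * L))%N + F (f, f.+1)).
Proof. exact: sum_constraints_edges. Qed.

Let hR : h%:R = 3 * c%:R - 1 :> R.
Proof. by rewrite natrB ?natrM // muln_gt0. Qed.

Lemma size_instance_edges :
  (size instance_edges)%:R = 12 * c%:R * M%:R * K%:R :> R.
Proof.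
rewrite -sum1_size natr_sum sum_instance_edges.
rewrite !sumr_const !card_ord hR -!mulrnA -[LHS]mulr_natr !natrM; ring.
Qed.

Lemma instance_edges_proper : all (proper_edge n) instance_edges.
Proof.
apply: constraints_edges_proper => // t i tM i4.
have := ltn_ord (w (Ordinal tM) (Ordinal i4)).
by rewrite -(rE (Ordinal tM) (Ordinal i4)).
Qed.

Notation G := (mkgraph n instance_edges).

Lemma edges_instance : [seq (nat_of_ord e.1, nat_of_ord e.2) | e <- edges G] = instance_edges.
Proof. exact/edges_mkgraph/instance_edges_proper. Qed.

Lemma sum_edges (F : nat * nat -> R) :
  \sum_(e <- edges G) F (nat_of_ord e.1, nat_of_ord e.2) = \sum_(e <- instance_edges) F e.
Proof. by rewrite -[in RHS]edges_instance big_map. Qed.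

Lemma size_edges : size (edges G) = size instance_edges.
Proof. by rewrite -[in RHS]edges_instance size_map. Qed.

Lemma objective_value x :
  (objective_poly R G).@[fun v : 'I_n => vertex_value v x] = 1 / 4 + 1 / (4 * c%:R).
Proof.
rewrite /objective_poly mevalZ raddf_sum /=.
under eq_bigr => e _ do rewrite mevalZ rmorphXn rmorphB /= !mevalXU.
rewrite (sum_edges (fun e => 4^-1 * (vertex_value e.1 x - vertex_value e.2 x) ^+ 2)).
rewrite sum_instance_edges size_edges size_instance_edges /=.
have [-> ->] := vertex_value_filler x.
have T (t : 'I_M) : \sum_(i < 4) \sum_(k < K)
   (h%:R * (4^-1 * (vertex_value (V0 + t * 2) x -
      vertex_value (i * L + r t i + k * (4 * L)) x) ^+ 2) +
      4^-1 * (1 - -1) ^+ 2) = K%:R * (h%:R + 4) :> R.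
  under eq_bigr => i _.
    under eq_bigr => k _ do rewrite vertex_value_aux vertex_value_lit //.
    rewrite sumr_const card_ord; over.
  rewrite sumrMnl -[LHS]mulr_natl; congr (_ * _); rewrite big_split /= -mulr_sumr -mulr_sumr.
  rewrite sumr_const card_ord.
  have -> : \sum_(i < 4) (aux t x - lit t i x) ^+ 2 = 4 :> R.
    rewrite big_ord4 /= /half_sum big_ord4 /=.
    have := lit_sqr R (var w) polarity t q0 x; have := lit_sqr R (var w) polarity t q1 x.
    have := lit_sqr R (var w) polarity t q2 x; have := lit_sqr R (var w) polarity t q3 x.
    move: (lit t q0 x) (lit t q1 x) (lit t q2 x) (lit t q3 x) => l0 l1 l2 l3 E3 E2 E1 E0.
    transitivity (l0 ^+ 2 + l1 ^+ 2 + l2 ^+ 2 + l3 ^+ 2); first by field.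
    by rewrite E0 E1 E2 E3; ring.
  by field.
under eq_bigr => t _ do rewrite T.
rewrite sumr_const card_ord -[_ *+ M]mulr_natl hR; field.
by rewrite !pnatr_eq0 -!lt0n K_gt0 M_gt0 c_gt0.
Qed.

Section SosSolution.
Variable d : nat.
Hypotheses (d_gt0 : (0 < d)%N) (expand : ~~ nonexpanding d w).

Lemma expandingP S : S != set0 -> (#|S| <= d.*2)%N -> (#|S| <= #|osum (var w) S|)%N.
Proof.
move=> S0 Sd; move: expand; rewrite negb_exists => /forallP/(_ S).
by rewrite S0 Sd /= -leqNgt.
Qed.

Lemma sos_solution : exists E : {mpoly R[n]} -> R,
  [/\ pseudoexpectation d E, pseudovariance_zero E (bisection_poly R n) 0
    & pseudovariance_zero E (objective_poly R G) (1 / 4 + 1 / (4 * c%:R))].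
Proof.
pose Lf := pmean (R := R) (var w) polarity d.
have L_lin a g1 g2 : Lf (fun x => a * g1 x + g2 x) = a * Lf g1 + Lf g2 by exact: pmean_lin.
have L_ext g1 g2 : g1 =1 g2 -> Lf g1 = Lf g2 by exact: pmean_ext.
have L1 : Lf (fun=> 1) = 1 by apply: pmean_one => // S; exact: expandingP.
have L_psd g : hasdeg d./2 g -> 0 <= Lf (fun x => g x ^+ 2).
  by apply: pmean_psd => // S; exact: expandingP.
pose u (v : 'I_n) := vertex_value v.
exists (lift Lf u); split.
- apply: pseudoexpectation_lift => //.
  move=> v; apply: hasdegZ; rewrite /pair_value; case: (v./2 < K * (4 * H))%N.
      apply: (hasdeg_ext (f := chi R [set pair_var v./2])).
        by move=> x; rewrite chi1.
      by apply: hasdeg_chi; rewrite cards1.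
    by case: insub => [t|]; [exact: hasdeg_half_sum | exact: hasdeg1].
- move=> v g gd d2; rewrite /u /vertex_value /pair_value; case: (v./2 < K * (4 * H))%N.
    by apply: L_ext => x; rewrite exprMn !sqrr_sign !mul1r.
  case: insub => [t|]; last by apply: L_ext => x; rewrite mulr1 sqrr_sign mul1r.
  rewrite -[RHS](pmean_half_sum_sqr polarity (@var_inj _ _ w) d_gt0 expandingP t gd d2).
  by apply: L_ext => x; rewrite exprMn sqrr_sign mul1r.
- apply: lift_const => // x; rewrite /bisection_poly raddf_sum /=.
  by under eq_bigr => v _ do rewrite mevalXU; exact: sum_vertex_value.
- by apply: lift_const => // x; exact: objective_value.
Qed.

End SosSolution.

Section Cuts.
Variable S : {set 'I_n}.
Hypothesis S_half : bisection S.

Definition side (v : nat) : R :=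
  if insub v is Some i then (if (i : 'I_n) \in S then 1 else -1) else 1.

Lemma side_sign v : exists z : bool, side v = (-1) ^+ z.
Proof.
rewrite /side; case: insub => [i|]; last by exists false; rewrite expr0.
by case: ifP => _; [exists false | exists true]; rewrite ?expr0 ?expr1.
Qed.

Lemma side_itv v : -1 <= side v <= 1.
Proof. by have [[] ->] := side_sign v; rewrite ?expr0 ?expr1; lra. Qed.

Lemma sum_side : \sum_(v < n) side v = 0.
Proof.
rewrite (eq_bigr (fun i : 'I_n => if i \in S then 1 else -1)); last first.
  by move=> i _; rewrite /side valK.
rewrite (bigID (fun i => i \in S)) /=.
rewrite (eq_bigr (fun=> 1)) => [|i ->] //.
rewrite [X in _ + X](eq_bigr (fun=> -1)) => [|i /negPf->] //.
have E := cardC (mem S); rewrite card_ord in E.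
have E2 : #|predC (mem S)| = #|S|.
  by apply: (@addnI #|S|); rewrite [LHS]E addnn; exact/esym.
rewrite !sumr_const (_ : #|[pred i | i \notin S]| = #|S|); last by rewrite -E2; apply: eq_card.
by rewrite mulNrn subrr.
Qed.

Definition cloud (p : 'I_4 * 'I_L) : R :=
  (\sum_(k < K) side (p.1 * L + p.2 + k * (4 * L))) / K%:R.

Let K0 : 0 < K%:R :> R. Proof. by rewrite ltr0n. Qed.

Lemma cloud_itv p : -1 <= cloud p <= 1.
Proof.
rewrite /cloud ler_pdivlMr // ler_pdivrMr // mulN1r mul1r.
have -> : K%:R = \sum_(k < K) 1 :> R by rewrite sumr_const card_ord.
rewrite -sumrN; apply/andP; split; apply: ler_sum => k _;
  by case/andP: (side_itv (p.1 * L + p.2 + k * (4 * L))).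
Qed.

Lemma sum_cloud_abs : `|\sum_p cloud p| <= (n - V0)%:R / K%:R.
Proof.
rewrite /cloud -mulr_suml normrM [X in _ * X]ger0_norm ?invr_ge0 ?(ltW K0) //.
apply: ler_wpM2r; first by rewrite invr_ge0 ltW.
have -> : \sum_(p : 'I_4 * 'I_L) \sum_(k < K) side (p.1 * L + p.2 + k * (4 * L)) =
    \sum_(v < V0) side v.
  rewrite (sum_ord_mul side) exchange_big /=; apply: eq_bigr => k _.
  rewrite (sum_ord_mul (fun j => side (k * (4 * L) + j))) pair_big /=.
  by apply: eq_bigr => p _; rewrite [RHS]/= addnC.
have V0n : (V0 <= n)%N by apply: leq_trans room; rewrite -addnA leq_addr.
have : \sum_(v < V0) side v + \sum_(v < n - V0) side (V0 + v) = 0.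
  by rewrite -[RHS]sum_side -[in RHS](subnKC V0n) big_split_ord.
move/eqP; rewrite addr_eq0 => /eqP ->; rewrite normrN.
apply: le_trans (ler_norm_sum _ _ _) _.
have -> : (n - V0)%:R = \sum_(v < n - V0) 1 :> R by rewrite sumr_const card_ord.
by apply: ler_sum => v _; rewrite ler_norml side_itv.
Qed.

Lemma count_cut : (count (fun e => (e.1 \in S) != (e.2 \in S)) (edges G))%:R =
  \sum_(e <- instance_edges) (1 - side e.1 * side e.2) / 2 :> R.
Proof.
rewrite -(sum_edges (fun e => (1 - side e.1 * side e.2) / 2)).
elim: (edges G) => [|e s IH]; first by rewrite big_nil.
rewrite big_cons /= natrD IH; congr (_ + _).
rewrite /side !valK; case: (e.1 \in S); case: (e.2 \in S); by rewrite /=; field.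
Qed.

Let cloud_ffun : {ffun 'I_4 * 'I_L -> R} := [ffun p => cloud p].

Lemma count_cut_ge :
  h%:R * K%:R * cost cloud_ffun w <= \sum_(e <- instance_edges) (1 - side e.1 * side e.2) / 2.
Proof.
rewrite sum_instance_edges /cost mulr_sumr; apply: ler_sum => t _ /=.
have [z zE] := side_sign (V0 + t * 2).
have Hq := @quad_le R (fun i => cloud (i, w t i)) z (fun i => cloud_itv _).
have -> : quad (fun i => cloud_ffun (i, w t i)) = quad (fun i => cloud (i, w t i)).
  by rewrite /quad !ffunE.
apply: le_trans (ler_wpM2l _ Hq) _; first by rewrite mulr_ge0.
apply: (@le_trans _ _ (\sum_(i < 4) \sum_(k < K)
    h%:R * ((1 - side (V0 + t * 2) * side (i * L + r t i + k * (4 * L))) / 2))); last first.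
  apply: ler_sum => i _; apply: ler_sum => k _; rewrite lerDl divr_ge0 // subr_ge0.
  by have [z1 ->] := side_sign f; have [z2 ->] := side_sign f.+1;
    case: z1; case: z2; rewrite ?expr0 ?expr1; lra.
rewrite le_eqVlt; apply/orP; left; apply/eqP.
have E (i : 'I_4) : \sum_(k < K)
    h%:R * ((1 - side (V0 + t * 2) * side (i * L + r t i + k * (4 * L))) / 2) =
    h%:R * K%:R * (1 - (-1) ^+ z * cloud (i, w t i)) / 2.
  rewrite zE /cloud /= rE -mulr_sumr -mulr_suml sumrB -mulr_sumr sumr_const card_ord.
  by field; exact: lt0r_neq0.
by rewrite (eq_bigr _ (fun i _ => E i)) !big_ord4 /=; field.
Qed.

Lemma cut_fraction_ge (tau : R) : ~~ cheap tau w ->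
  c%:R * (n - V0)%:R <= (K * L)%:R :> R -> tau <= 1 / (4 * c%:R) ->
  5 / 16 - 1 / (4 * c%:R) <= cut_fraction R G S.
Proof.
move=> Hw HK Ht.
have M0 : 0 < M%:R :> R by rewrite ltr0n.
have c0 : 0 < c%:R :> R by rewrite ltr0n.
have c1 : 1 <= c%:R :> R by rewrite ler1n.
have L0 : 0 < L%:R :> R by rewrite ltr0n.
rewrite /cut_fraction count_cut size_edges size_instance_edges.
rewrite ler_pdivlMr ?mulr_gt0 //.
apply: le_trans count_cut_ge.
have ci p : -1 <= cloud_ffun p <= 1 by rewrite ffunE cloud_itv.
have := cost_ge L_gt0 Hw ci => Hc.
have Hq := quad_ge (mean_itv L_gt0 ci).
have Sm : \sum_i mean cloud_ffun i = (\sum_p cloud p) / L%:R.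
  rewrite -mulr_suml pair_big /=; congr (_ / _).
  by apply: eq_bigr => -[i l] _; rewrite ffunE.
have Sc : (\sum_i mean cloud_ffun i) ^+ 2 <= (1 / c%:R) ^+ 2.
  rewrite -[leLHS]real_normK ?num_real // lerXn2r ?nnegrE // ?divr_ge0 //.
  rewrite Sm normrM [X in _ * X]ger0_norm ?invr_ge0 ?(ltW L0) // ler_pdivrMr //.
  apply: le_trans sum_cloud_abs _; rewrite ler_pdivrMr //.
  rewrite (_ : 1 / c%:R * L%:R * K%:R = (K * L)%:R / c%:R).
    by rewrite ler_pdivlMr // mulrC.
  by rewrite natrM; field; exact: lt0r_neq0.
have h0 : 0 <= h%:R * K%:R :> R by rewrite mulr_ge0.
apply: le_trans (ler_wpM2l h0 Hc).
have E : 5 / 4 - 1 / (8 * c%:R ^+ 2) - 1 / (4 * c%:R) <= quad (mean cloud_ffun) - tau.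
  apply: lerB => //; apply: le_trans Hq; rewrite lerD2l lerN2.
  rewrite (_ : 1 / (8 * _) = (1 / c%:R) ^+ 2 / 8).
    by apply: ler_wpM2r Sc; rewrite invr_ge0.
  by field; exact: lt0r_neq0.
apply: le_trans (ler_wpM2l h0 (ler_wpM2l (ltW M0) E)).
rewrite hR -subr_ge0.
rewrite [X in 0 <= X](_ : _ = M%:R * K%:R * (1 - (8 * c%:R)^-1 + (8 * c%:R ^+ 2)^-1)); last first.
  by field; exact: lt0r_neq0.
apply: mulr_ge0; first exact: mulr_ge0.
apply: addr_ge0; last by rewrite invr_ge0 mulr_ge0 // sqr_ge0.
rewrite subr_ge0 invf_le1 ?mulr_gt0 //; lra.
Qed.

End Cuts.

End Instance.

(** * Choice of the parameters *)

Section RunTime.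
Local Open Scope nat_scope.

Lemma block_size_le C n : block_size C n <= n.+1.
Proof.
rewrite /block_size /log_size; case: (posnP (n %/ C)) => [->|q0].
  by rewrite trunc_log0.
apply: leq_trans (trunc_logP (isT : 1 < 2) q0) _.
by apply: leq_trans (leq_div _ _) _.
Qed.

Lemma run_time_poly C D h : exists k, forall n, run_time C D h n <= n ^ k + k.
Proof.
pose A := 85 + 6 * D + D * (4 * (14 * h + 56) + 16); exists (4 * A + 2) => n.
have TA : run_time C D h n <= A * n.+1 ^ 2.
  have bn : log_size C n <= n.+1 by apply/ltnW/(leq_trans (ltn_expl _ (isT : 1 < 2)))/block_size_le.
  have Kn : copy_count C D n <= n.+1.
    by apply: leq_trans (leq_div _ _) _; rewrite leqW // !leq_subLR; lia.
  have Mn : constraint_count C D n <= D * n.+1 by rewrite leq_mul2l block_size_le orbT.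
  have Kh : copy_count C D n * (h * 14 + 22) <= n.+1 * (h * 14 + 22) by rewrite leq_mul2r Kn orbT.
  rewrite /run_time /start_time /constraint_time /literal_time.
  set Z := (X in (_ + X).+1); pose Y := D * (4 * (14 * h + 56) + 16).
  have H1 : Z <= Y * n.+1 ^ 2.
    rewrite /Y -mulnn -mulnA [X in _ <= _ * X]mulnCA (mulnA D); apply: leq_mul => //.
    by move: Kh; rewrite !mulnDl !mulnDr; lia.
  have n2 : n.+1 <= n.+1 ^ 2 by rewrite -mulnn leq_pmulr.
  have H2 : (85 + 6 * D) * n.+1 <= (85 + 6 * D) * n.+1 ^ 2 by rewrite leq_mul2l n2 orbT.
  have H3 : 6 * D <= 6 * D * n.+1 by rewrite leq_pmulr.
  rewrite (mulnDl 85 (6 * D) n.+1) in H2.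
  rewrite /A -/Y (mulnDl _ Y); lia.
apply: leq_trans TA _; case: n => [|[|n]].
- by rewrite exp1n; lia.
- by rewrite -[2 ^ 2]/4; lia.
have : 4 * A * n.+2 ^ 2 <= n.+2 ^ (4 * A + 2).
  rewrite expnD leq_mul2r; apply/orP; right.
  apply: leq_trans (ltnW (ltn_expl _ (isT : 1 < 2))) _.
  by case: (4 * A) => // m; rewrite leq_exp2r.
have : n.+3 ^ 2 <= 4 * n.+2 ^ 2 by rewrite -!mulnn; nia.
move: (n.+2 ^ (4 * A + 2)) => z; rewrite -!mulnn; nia.
Qed.

End RunTime.

Section Sizes.
Local Open Scope nat_scope.
Variable c : nat.
Hypothesis c_gt0 : 0 < c.

(* [density / (4 c) ^ 2 = 1440] is what [card_cheap] asks for, and [scale] makes the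
   copies of the literals outnumber the other vertices [c] to one. *)
Definition density := 23040 * c ^ 2.
Definition scale := 4 * (c * (2 * density + 6)) + 2 * density + 2.
Definition fan := 3 * c - 1.

Notation D := density.
Notation C := scale.
Notation h := fan.
Notation b := (log_size C).
Notation L := (block_size C).
Notation M := (constraint_count C D).
Notation K := (copy_count C D).
Notation T := (run_time C D h).

Lemma scale_gt0 : 0 < C. Proof. by rewrite /scale addn2. Qed.

Lemma density_gt0 : 0 < D. Proof. by rewrite muln_gt0 expn_gt0 c_gt0. Qed.

Lemma block_size_gt0 n : 0 < L n. Proof. by rewrite expn_gt0. Qed.

Definition random_graph n (w : (T n).-tuple bool) : multigraph n :=
  mkgraph n (emitted C D h n (nth false w)).

Lemma copy_count_room n : 0 < K n -> K n * (4 * L n) + M n * 2 + 2 <= n.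
Proof.
move=> K0; have := leq_divM (n - 2 * M n - 2) (4 * L n); rewrite -/(K n).
have : 1 <= K n * (4 * L n) by rewrite !muln_gt0 K0 block_size_gt0.
lia.
Qed.

Lemma random_graph_samplable : efficiently_samplable random_graph.
Proof.
have [k Hk] := run_time_poly C D h; exists (program C D h), k; split=> // n n_even w.
have [-> ->] := run_program scale_gt0 w; split=> //.
rewrite edges_mkgraph //; apply: constraints_edges_proper; last exact: copy_count_room.
by move=> t i _ _; exact: bitval_lt.
Qed.

Lemma large_instance n N : 0 < N -> 2 * C * N <= n ->
  [/\ N < L n, L n * C <= n, n < 2 * (L n * C), K n * (4 * L n) + M n * 2 + 2 <= n
    & c * (n - K n * (4 * L n)) <= K n * L n] /\ 0 < K n.
Proof.
move=> N0 Nn; have Cpos := scale_gt0.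
have up : n < 2 * (L n * C) by have := @double_exit C Cpos n; rewrite expnS mulnA.
have NL : N < L n.
  have : 2 * C * N < 2 * C * L n by apply: leq_ltn_trans Nn _; rewrite -mulnA (mulnC C).
  by rewrite ltn_mul2l => /andP[].
have lo : L n * C <= n.
  rewrite -leq_divRL //; apply: trunc_logP => //.
  rewrite divn_gt0 //; apply: leq_trans Nn; rewrite (mulnC 2) -mulnA leq_pmulr //.
  by rewrite muln_gt0.
have L1 := block_size_gt0 n.
have KK : c * (2 * D + 6) <= K n.
  rewrite /copy_count leq_divRL ?muln_gt0 //.
  have : L n * C = c * (2 * D + 6) * (4 * L n) + 2 * (D * L n) + 2 * L n.
    by rewrite /scale; ring.
  rewrite /constraint_count -/(L n); lia.
have K0 : 0 < K n by apply: leq_trans KK; rewrite muln_gt0 c_gt0 addn_gt0 orbT.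
split=> //; split=> //; first exact: copy_count_room.
have ex : n - 2 * M n - 2 < (K n).+1 * (4 * L n) by rewrite -ltn_divLR ?muln_gt0.
have gap : n - K n * (4 * L n) <= (2 * D + 6) * L n.
  have -> : (2 * D + 6) * L n = 2 * M n + 6 * L n by rewrite /constraint_count -/(L n); ring.
  rewrite mulSn in ex; lia.
apply: leq_trans (leq_mul (leqnn c) gap) _.
by rewrite mulnA leq_mul2r KK orbT.
Qed.

End Sizes.

Lemma random_graph_gap (R : realType) (c : nat) : (0 < c)%N ->
  exists2 delta : R, 0 < delta &
  forall eta : R, 0 < eta -> exists n0 : nat,
    forall n : nat, (n0 <= n)%N -> ~~ odd n ->
      1 - eta <= coin_prob R (fun w : (run_time (scale c) (density c) (fan c) n).-tuple bool =>
        (exists (d : nat) (E : {mpoly R[n]} -> R),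
          [/\ delta * n%:R <= d%:R,
              pseudoexpectation d E,
              pseudovariance_zero E (bisection_poly R n) 0
            & pseudovariance_zero E (objective_poly R (random_graph w))
                (1 / 4 + 1 / (4 * c%:R))]) /\
        (forall S : {set 'I_n}, bisection S ->
          5 / 16 - 1 / (4 * c%:R) <= cut_fraction R (random_graph w) S)).
Proof.
move=> c_gt0; set D := density c; set C := scale c.
have D0 : (0 < D)%N by exact: density_gt0.
have [B BE] : exists B, B = (128 * D)%N by eexists.
have B0 : (0 < B)%N by rewrite BE muln_gt0.
have C0 : (0 < C)%N by exact: scale_gt0.
have [q qE] : exists q, q = (16 * B ^ 2)%N by eexists.
have q0 : (0 < q)%N by rewrite qE muln_gt0 expn_gt0 B0.
exists (4 * C * q)%:R^-1 => [|eta eta0].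
  by rewrite invr_gt0 ltr0n !muln_gt0 C0 q0.
pose X : R := 2 / eta + 128 * B%:R ^+ 2 / eta ^+ 2.
have X0 : 0 <= X by rewrite addr_ge0 ?divr_ge0 ?mulr_ge0 ?exprn_ge0 // ltW.
exists (2 * C * (Num.bound X + q))%N => n Nn n_even.
have Nq : (0 < Num.bound X + q)%N by rewrite addn_gt0 q0 orbT.
have := large_instance c_gt0 Nq Nn.
rewrite -/C -/D; set L := block_size C n; set M := constraint_count C D n.
set K := copy_count C D n => -[[NL lo up room gap] K0].
have L0 : (0 < L)%N by exact: leq_ltn_trans NL.
have qL : (q <= L)%N by apply: leq_trans (ltnW NL); exact: leq_addl.
have XL : X <= L%:R.
  apply: (@le_trans _ _ (Num.bound X)%:R); first exact/ltW/archi_boundP.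
  by rewrite ler_nat; apply: leq_trans (ltnW NL); exact: leq_addr.
have LR : 0 < L%:R :> R by rewrite ltr0n.
have cR : 0 < c%:R :> R by rewrite ltr0n.
have c1 : 1 <= c%:R :> R by rewrite ler1n.
pose d := (L %/ q)%N.
have d0 : (0 < d)%N by rewrite divn_gt0.
pose tau : R := 1 / (4 * c%:R).
have tau01 : 0 < tau <= 1.
  by rewrite /tau divr_gt0 ?mulr_gt0 //= ler_pdivrMr ?mulr_gt0 //; lra.
pose p1 : R := 4 * B%:R * Num.sqrt (2 / L%:R).
pose p2 : R := (1 + L%:R)^-1.
have p2e : p2 <= eta / 2.
  have : 2 / eta <= L%:R.
    by apply: le_trans XL; rewrite lerDl divr_ge0 ?mulr_ge0 ?exprn_ge0 // ltW.
  rewrite ler_pdivrMr // => H.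
  by rewrite /p2 -div1r ler_pdivrMr ?addr_gt0 //; nra.
have p1e : p1 <= eta / 2.
  have : 128 * B%:R ^+ 2 / eta ^+ 2 <= L%:R.
    by apply: le_trans XL; rewrite lerDr divr_ge0 // ltW.
  rewrite ler_pdivrMr ?exprn_gt0 // => H.
  rewrite /p1 -(ler_pXn2r (n := 2)) ?nnegrE ?divr_ge0 ?mulr_ge0 ?sqrtr_ge0 ?(ltW eta0) //.
  rewrite exprMn sqr_sqrtr ?divr_ge0 // mulrA ler_pdivrMr //.
  rewrite !expr2 in H *; lra.
apply: (@le_trans _ _ (1 - (p1 + p2))); first by lra.
apply: (@coin_prob_ge R C D (fan c) n (nonexpanding d) (cheap tau)) => //; last first.
- apply: card_cheap => //.
  rewrite /D /density natrM natrX /tau le_eqVlt; apply/orP; left; apply/eqP; field.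
  exact: lt0r_neq0.
- rewrite /p1 BE; apply: card_nonexpanding => //.
  by rewrite -BE -qE mulnC leq_divM.
move=> w exp bal.
have b0 : (0 < log_size C n)%N.
  have : (1 < L)%N by apply: leq_ltn_trans NL; rewrite addn_gt0 q0 orbT.
  by rewrite /L /block_size; case: (log_size C n).
have H0 : (0 < 2 ^ (log_size C n).-1)%N by rewrite expn_gt0.
have LH : L = (2 ^ (log_size C n).-1).*2 by rewrite -mul2n -expnS prednK.
have M0 : (0 < M)%N by rewrite muln_gt0 D0.
have rE (t : 'I_M) (i : 'I_4) :
    sampled (fan c) (nth false w) (log_size C n) K (start_time C D n) t i = sample w t i.
  by rewrite !ffunE.
split.
  have [E [E1 E2 E3]] := sos_solution R H0 LH K0 M0 c_gt0 room n_even rE d0 exp.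
  exists d, E; split=> //.
  rewrite ler_pdivrMl ?ltr0n ?muln_gt0 ?C0 // -natrM ler_nat.
  apply: ltnW; apply: leq_trans up _.
  have Ld : (L <= 2 * d * q)%N.
    apply: (@leq_trans (d.+1 * q)); first by rewrite ltnW // -ltn_divLR.
    by rewrite leq_mul2r; apply/orP; right; rewrite mul2n -addnn -addn1 leq_add2l.
  have -> : (4 * C * q * d = 2 * (2 * d * q * C))%N by ring.
  by rewrite leq_mul2l leq_mul2r Ld orbT.
move=> S HS; have gapR : c%:R * (n - K * (4 * L))%:R <= (K * L)%:R :> R.
  by rewrite -natrM ler_nat.
have Hc := cut_fraction_ge H0 LH K0 M0 c_gt0 room rE HS bal gapR (lexx _).
exact Hc.
Qed.

Lemma pseudoexpectation_le (R : realType) n d d' (E : {mpoly R[n]} -> R) :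
  (d <= d')%N -> pseudoexpectation d' E -> pseudoexpectation d E.
Proof.
move=> dd [E1 E2 E3 E4].
have dle p : degree_le d p -> degree_le d' p.
  by move=> H; apply: leq_trans H _.
split=> // [a p q /dle Hp /dle Hq | v p /dle Hp | q Hq]; [exact: E1 | exact: E3 |].
by apply: E4; apply: leq_trans Hq _; rewrite ltnS half_leq.
Qed.

Lemma coin_prob_gt0 (R : realType) (T : nat) (A : T.-tuple bool -> Prop) :
  0 < coin_prob R A -> exists w, A w.
Proof.
rewrite /coin_prob => H; apply: contrapT => nA; move: H.
rewrite (_ : [set w | `[< A w >]] = set0) ?cards0 ?mul0r ?ltxx //.
apply/setP => w; rewrite !inE; apply/asboolP => Aw; apply: nA; by exists w.
Qed.

Theorem theorem15 (R : realType) :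
  (forall (c : nat) (eps : R), (0 < c)%N -> ~~ odd c -> eps = 1 / (4 * c%:R) ->
    exists (T : nat -> nat) (G : forall n, (T n).-tuple bool -> multigraph n)
           (delta : R),
      [/\ efficiently_samplable G,
          0 < delta
        & forall eta : R, 0 < eta -> exists n0 : nat,
          forall n : nat, (n0 <= n)%N -> ~~ odd n ->
            1 - eta <= coin_prob R (fun w : (T n).-tuple bool =>
              (exists (d : nat) (E : {mpoly R[n]} -> R),
                [/\ delta * n%:R <= d%:R,
                    pseudoexpectation d E,
                    pseudovariance_zero E (bisection_poly R n) 0
                  & pseudovariance_zero E (objective_poly R (G n w))
                      (1 / 4 + eps)]) /\
              (forall S : {set 'I_n}, bisection S ->
                5 / 16 - eps <= cut_fraction R (G n w) S))])
  /\
  (forall eps : R, 0 < eps ->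
    forall d : nat -> nat, little_o_n R d ->
      ~ sos_approximates d (5 / 4 - eps)).
Proof.
split=> [c eps c_gt0 _ -> | eps eps0 d d_small [n1 approx]].
  have [delta delta0 Hd] := random_graph_gap R c_gt0.
  exists (run_time (scale c) (density c) (fan c)), (random_graph (c := c)), delta.
  by split=> //; exact: random_graph_samplable.
pose c := (Num.bound (9 / (4 * eps))).+1.
have c_gt0 : (0 < c)%N by [].
have cR : 0 < c%:R :> R by rewrite ltr0n.
have ceps : 9 * (1 / (4 * c%:R)) < eps.
  have e9 : 9 / (4 * eps) < c%:R.
    apply: lt_le_trans (archi_boundP _) _; first by rewrite divr_ge0 // mulr_ge0 // ltW.
    by rewrite ler_nat.
  rewrite ltr_pdivrMr ?mulr_gt0 // in e9.
  by rewrite mulrA mulr1 ltr_pdivrMr ?mulr_gt0 //; lra.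
have [delta delta0 Hd] := random_graph_gap R c_gt0.
have [n2 small] := d_small delta delta0.
have half0 : 0 < 1 / 2 :> R by rewrite divr_gt0.
have [n0 gap] := Hd (1 / 2) half0.
pose n := (n0 + n1 + n2).*2.
have nn (k : nat) : (k <= n0 + n1 + n2)%N -> (k <= n)%N.
  by move=> H; rewrite /n -addnn; apply: leq_trans H (leq_addr _ _).
have n_even : ~~ odd n by rewrite odd_double.
have := gap n (nn _ _) n_even; rewrite -addnA leq_addr => /(_ isT) Hp.
have [|w [[d' [E [dE pE bE oE]]] cut]] := @coin_prob_gt0 R _ _ (lt_le_trans _ Hp); first by lra.
have dd : (d n <= d')%N.
  rewrite -(ler_nat R); apply: le_trans dE; apply: small; apply: nn; exact: leq_addl.
have {}pE := pseudoexpectation_le dd pE.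
have c0 : 0 < 1 / (4 * c%:R) :> R by rewrite divr_gt0 ?mulr_gt0.
have ne : edges (random_graph w) <> [::].
  move=> e0; case: oE; rewrite /objective_poly e0 big_nil scaler0.
  case: pE => lin _ _ _; have := lin 1 0 0; rewrite /degree_le msize0 scaler0 addr0 mul1r.
  by move=> /(_ isT isT) => E0 E1 _; lra.
have n1n : (n1 <= n)%N by apply: nn; rewrite addnAC leq_addl.
have [S HS le_cut] := approx n n1n n_even (random_graph w) ne E pE bE.
have := cut S HS; move: le_cut; case: oE => -> _ H1 H2.
have H3 := le_trans H2 H1; have H4 := mulr_gt0 eps0 c0.
lra.
Qed.
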